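(* Let $X$ and $Y$ be distinct nodes in an MPDAG $\mathcal G=(\mathbf V,\mathbf E)$. If $Y\notin\mathrm{Pa}(X,\mathcal G)$, then the causal effect of $X$ on $Y$ is identifiable in $\mathcal G$ if and only if there is an adjustment set relative to $(X,Y)$ in $\mathcal G$. Furthermore, if $Y\notin\mathrm{Pa}(X,\mathcal G)$, then $\mathrm{Pa}(X,\mathcal G)$ is an adjustment set relative to $(X,Y)$ in $\mathcal G$ whenever one such set exists.
   Context: Graphs. A graph $\mathcal G=(\mathbf V,\mathbf E)$ has a finite node set $\mathbf V$ and edges that are directed ($\to$) or undirected ($-$), at most one edge between any two nodes. A causal path from $X$ to $Y$ is a sequence of distinct nodes from $X$ to $Y$, successive nodes adjacent, with all edges pointing towards $Y$. A directed cycle is a causal path from $X$ to $Y$ together with $Y\to X$. A PDAG is a graph with directed and undirected edges and no directed cycle; a DAG is a PDAG with only directed edges. $\mathrm{Pa}(X,\mathcal G)=\{W: W\to X \text{ in }\mathcal G\}$. MPDAGs. An unshielded collider is $A\to B\leftarrow C$ with $A,C$ nonadjacent. A DAG $\mathcal D$ is represented by $\mathcal G$ if it has the same adjacencies and the same unshielded colliders as $\mathcal G$ and every directed edge $X\to Y$ of $\mathcal G$ is in $\mathcal D$; $[\mathcal G]$ is the set of all such DAGs. An MPDAG (maximally oriented PDAG) is a PDAG $\mathcal G$ with $[\mathcal G]\neq\emptyset$ having none of the following as an induced subgraph: (a) $K\to I$, $I-J$, with $K,J$ nonadjacent; (b) $I\to K\to J$, $I-J$; (c) $K\to J$, $L\to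 J$, $I-J$, $I-K$, $I-L$, with $K,L$ nonadjacent; (d) $J\to L$, $L\to K$, $I-K$, $I-J$, $I-L$, with $J,K$ nonadjacent. Densities. Nodes also denote random variables (real-valued, say); a density $f$ of $\mathbf V$ is an observational density consistent with a DAG $\mathcal D=(\mathbf V,\mathbf E)$ if $f(\mathbf v)=\prod_{V_i\in\mathbf V}f(v_i\mid \mathrm{pa}(v_i,\mathcal D))$; it is consistent with an MPDAG $\mathcal G$ if it is consistent with some DAG in $[\mathcal G]$. Given $f$ consistent with $\mathcal D$, $\mathbf X\subset\mathbf V$ and $\mathbf V'=\mathbf V\setminus\mathbf X$, the interventional density consistent with $\mathcal D$ is $f(\mathbf v'\mid do(\mathbf x))=\prod_{V_i\in\mathbf V'}f(v_i\mid\mathrm{pa}(v_i,\mathcal D))$ for values $\mathrm{pa}(v_i,\mathcal D)$ of $\mathrm{Pa}(V_i,\mathcal D)$ in agreement with $\mathbf x$; for $\mathbf Y\subseteq\mathbf V'$, $f(\mathbf y\mid do(\mathbf x))$ is its marginal density of $\mathbf Y$. Identities are understood where the conditional densities involved are well defined. Identifiability. The causal effect of $\mathbf X$ on $\mathbf Y$ is identifiable in $\mathcal G$ if $f(\mathbf y\mid do(\mathbf x))$ is uniquely computable from any observational density consistent with $\mathcal G$; that is, there are no two DAGs $\mathcal D^1,\mathcal D^2$ in $[\mathcal G]$ such that (1) $f_1(\mathbf v)=f_2(\mathbf v)=f(\mathbf v)$ for an observational density $f$ consistent with $\mathcal G$, and (2) $f_1(\mathbf y\mid do(\mathbf x))\neq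 f_2(\mathbf y\mid do(\mathbf x))$, where $f_1(\cdot\mid do(\mathbf x))$ and $f_2(\cdot\mid do(\mathbf x))$ are the interventional densities consistent with $\mathcal D^1$ and $\mathcal D^2$ (formed from $f_1$ and $f_2$) respectively. Adjustment set. For pairwise disjoint node sets $\mathbf X,\mathbf Y,\mathbf Z$ in $\mathcal G$, $\mathbf Z$ (possibly empty) is an adjustment set relative to $(\mathbf X,\mathbf Y)$ in $\mathcal G$ if for every observational density $f$ consistent with $\mathcal G$ (and every DAG in $[\mathcal G]$ used to form the interventional density), $f(\mathbf y\mid do(\mathbf x))=\int f(\mathbf y\mid\mathbf x,\mathbf z)f(\mathbf z)\,d\mathbf z$ if $\mathbf Z\neq\emptyset$, and $f(\mathbf y\mid do(\mathbf x))=f(\mathbf y\mid\mathbf x)$ if $\mathbf Z=\emptyset$. Singletons $\{X\},\{Y\}$ are written $X,Y$. *)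

(* Defs.v *)
From HB Require Import structures.
From mathcomp Require Import all_boot all_order all_algebra.
From mathcomp Require Import all_classical all_reals all_analysis.
From mathcomp Require Import measurable_realfun.
Set Implicit Arguments.
Unset Strict Implicit.
Unset Printing Implicit Defensive.
Import Order.TTheory GRing.Theory Num.Theory.
Import numFieldNormedType.Exports.
Local Open Scope ring_scope.

(** * Graphs *)

(* [arrow x y] is x -> y and [line x y] is x - y.  [one_edge] with y := x also
   rules out directed loops. *)
Record mixed_graph (V : finType) := MixedGraph {
  arrow : rel V;
  line : rel V;
  line_sym : symmetric line;
  line_irr : irreflexive line;
  one_edge : forall x y, arrow x y -> ~~ arrow y x && ~~ line x y
}.

Section graphs.
Variable V : finType.
Implicit Types G D : mixed_graph V.

Definition adjacent G : rel V :=
  fun x y => [|| arrow G x y, arrow G y x | line G x y].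

Definition Pa G (x : V) : {set V} := [set w | arrow G w x]%SET.

(* x :: p lists the successive nodes of the path. *)
Definition causal_path G (x y : V) (p : seq V) : bool :=
  [&& path (arrow G) x p, uniq (x :: p) & last x p == y].

Definition pdag G : Prop :=
  forall x y p, causal_path G x y p -> ~~ arrow G y x.

Definition dag D : Prop := pdag D /\ forall x y, ~~ line D x y.

Definition unshielded_collider G (a b c : V) : bool :=
  [&& a != c, arrow G a b, arrow G c b & ~~ adjacent G a c].

(* D \in [G] *)
Definition represented G D : Prop :=
  [/\ dag D,
      adjacent D =2 adjacent G,
      forall a b c, unshielded_collider D a b c = unshielded_collider G a b c
    & forall x y, arrow G x y -> arrow D x y].

(* The four forbidden induced subgraphs; "induced" means that the edges not
   listed between the displayed (distinct) nodes are absent. *)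
Definition forbidden_a G (i j k : V) : bool :=
  [&& uniq [:: i; j; k],
      arrow G k i, line G i j & ~~ adjacent G k j].

Definition forbidden_b G (i j k : V) : bool :=
  [&& uniq [:: i; j; k],
      arrow G i k, arrow G k j & line G i j].

Definition forbidden_c G (i j k l : V) : bool :=
  [&& uniq [:: i; j; k; l],
      arrow G k j, arrow G l j,
      line G i j, line G i k, line G i l & ~~ adjacent G k l].

Definition forbidden_d G (i j k l : V) : bool :=
  [&& uniq [:: i; j; k; l],
      arrow G j l, arrow G l k,
      line G i k, line G i j, line G i l & ~~ adjacent G j k].

Definition mpdag G : Prop :=
  [/\ pdag G,
      exists D, represented G D,
      forall i j k, ~~ forbidden_a G i j k && ~~ forbidden_b G i j k
    & forall i j k l, ~~ forbidden_c G i j k l && ~~ forbidden_d G i j k l].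

End graphs.

(** * The measure space of joint values v of the nodes *)

(* R^V with its product sigma-algebra, generated by the coordinate maps. *)
Definition cylinders (R : realType) (V : finType) : set (set (V -> R)) :=
  [set A | exists i (B : set (measurableTypeR R)),
     measurable B /\ A = [set v : V -> R | B (v i)]]%classic.

Notation valuation R V := (g_sigma_algebraType (@cylinders R V)).

Section lebesgue.
Variables (R : realType) (V : finType).
Local Open Scope ereal_scope.

Definition upd (v : valuation R V) (i : V) (t : R) : valuation R V :=
  fun j => if j == i then t else v j.

(* Iterated Lebesgue integral over the coordinates listed in s, the other
   coordinates being those of v. *)
Fixpoint int_seq (s : seq V) (F : valuation R V -> \bar R)
    (v : valuation R V) : \bar R :=
  if s is i :: s' then \int[lebesgue_measure]_t int_seq s' F (upd v i t)
  else F v.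

Definition int_over (S : {set V}) := int_seq (enum S).

(* Lebesgue measure on R^V; the base point is immaterial since all the
   coordinates are integrated out. *)
Definition lebesgueV (A : set (valuation R V)) : \bar R :=
  int_over [set: V]%SET (fun v => (\1_A v)%:E) (fun=> 0%R).

Let measurable_upd i : measurable_fun [set: valuation R V * measurableTypeR R]
  (fun p => upd p.1 i p.2).
Proof.
apply: (@measurability _ _ _ (valuation R V) setT _ (@cylinders R V)) => //.
move=> _ [_ [j [B [mB ->]]] <-].
rewrite setTI.
have [->|ji] := eqVneq j i.
  rewrite [X in measurable X](_ : _ = [set: valuation R V] `*` B)%classic.
    exact: measurableX.
  by apply/seteqP; split=> -[v t]; rewrite /= /upd eqxx// => -[].
rewrite [X in measurable X](_ : _ =
    [set v : valuation R V | B (v j)] `*` [set: measurableTypeR R])%classic.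
  apply: measurableX => //; apply: sub_sigma_algebra.
  by exists j, B.
by apply/seteqP; split=> -[v t]; rewrite /= /upd (negPf ji)// => -[].
Qed.

Lemma int_seq_ge0 s (F : valuation R V -> \bar R) v :
  (forall v, 0 <= F v) -> 0 <= int_seq s F v.
Proof.
move=> F0; elim: s v => [|i s IH] v //=.
by apply: integral_ge0 => t _; exact: IH.
Qed.

Lemma measurable_int_seq s (F : valuation R V -> \bar R) :
  (forall v, 0 <= F v) -> measurable_fun [set: valuation R V] F ->
  measurable_fun [set: valuation R V] (int_seq s F).
Proof.
move=> F0 mF; elim: s => [|i s IH] //=.
apply: (@measurable_fun_fubini_tonelli_F _ _ (valuation R V)
  (measurableTypeR R) R lebesgue_measure
  (fun p => int_seq s F (upd p.1 i p.2))).
- exact: (measurableT_comp IH (measurable_upd i)).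
- by move=> p; exact: int_seq_ge0.
Qed.

Lemma measurable_int_seq_upd s (F : valuation R V -> \bar R) v i :
  (forall v, 0 <= F v) -> measurable_fun [set: valuation R V] F ->
  measurable_fun [set: measurableTypeR R]
    (fun t => int_seq s F (upd v i t)).
Proof.
move=> F0 mF; apply: (measurableT_comp (measurable_int_seq s F0 mF)).
exact: (measurableT_comp (measurable_upd i) (pair1_measurable v)).
Qed.

Lemma int_seq_nneseries s (F : (valuation R V -> \bar R)^nat) v :
  (forall n v, 0 <= F n v) -> (forall n, measurable_fun [set: valuation R V] (F n)) ->
  int_seq s (fun v => \sum_(n <oo) F n v) v = \sum_(n <oo) int_seq s (F n) v.
Proof.
move=> F0 mF; elim: s v => [|i s IH] v //=.
under eq_integral do rewrite IH.
rewrite integral_nneseries// => n.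
- exact: measurable_int_seq_upd.
- by move=> t _; exact: int_seq_ge0.
Qed.

Let lebesgueV0 : lebesgueV set0 = 0.
Proof.
rewrite /lebesgueV /int_over; move: (fun=> 0%R : R) => v.
elim: (enum _) v => [|i s IH] v /=; first by rewrite indic0.
by apply: integral0_eq => t _; exact: IH.
Qed.

Let lebesgueV_ge0 A : 0 <= lebesgueV A.
Proof. by apply: int_seq_ge0 => v; rewrite lee_fin. Qed.

Let lebesgueV_sigma_additive : semi_sigma_additive lebesgueV.
Proof.
move=> A mA tA mUA.
rewrite [X in (_ --> X)%classic](_ : _ = \sum_(n <oo) lebesgueV (A n)).
  by apply: is_cvg_nneseries => *; exact: lebesgueV_ge0.
rewrite /lebesgueV /int_over -int_seq_nneseries//; last first.
  by move=> n; apply/measurable_EFinP; exact: measurable_indic.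
by congr int_seq; apply/funext => v; rewrite indic_bigcup.
Qed.

HB.instance Definition _ := isMeasure.Build _ _ _ lebesgueV
  lebesgueV0 lebesgueV_ge0 lebesgueV_sigma_additive.

End lebesgue.

(** * Densities *)

Section densities.
Variables (R : realType) (V : finType).
Implicit Types (f : valuation R V -> R) (v w : valuation R V).
Implicit Types (A B X Y Z : {set V}) (G D : mixed_graph V).
Local Open Scope ereal_scope.

Definition density f : Prop :=
  [/\ measurable_fun [set: valuation R V] f,
      forall v, (0 <= f v)%R
    & \int[@lebesgueV R V]_v (f v)%:E = 1].

(* The marginal density f(a), as a function of v through v_A only.  It is
   finite for almost every v, but possibly not for all. *)
Definition marginal f A v : \bar R := int_over (~: A)%SET (EFin \o f) v.

(* f( . | b) is well defined at b = v_B. *)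
Definition cond_defined f B v : bool := (0 < marginal f B v < +oo).

(* f(a | b), with value 0 where [cond_defined f B] fails; f(a, b) itself is
   infinite on a null set only. *)
Definition cond_density f A B v : R :=
  (fine (marginal f (A :|: B)%SET v) / fine (marginal f B v))%R.

(* Densities are identified when equal almost everywhere.  Where a factor is
   not well defined, f(pa(v_i)) = 0 (up to a null set), so that both sides
   vanish almost everywhere. *)
Definition dag_consistent D f : Prop :=
  {ae @lebesgueV R V, forall v,
     f v = (\prod_(i : V) cond_density f [set i]%SET (Pa D i) v)%R}.

Definition consistent G f : Prop :=
  exists2 D, represented G D & dag_consistent D f.

(* f(v' | do(x)) and f(y | do(x)), at x = v_X, v' = v_(V \ X), y = v_Y. *)
Definition do_joint D f X v : R :=
  (\prod_(i | i \notin X) cond_density f [set i]%SET (Pa D i) v)%R.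

Definition do_density D f X Y v : \bar R :=
  int_over (~: (X :|: Y))%SET (EFin \o do_joint D f X) v.

(* The values of v on X and of w elsewhere. *)
Definition fix_on X v w : valuation R V :=
  fun i => if i \in X then v i else w i.

(* f( . | do(x)) is well defined at x = v_X: for almost every v', the product
   is, i.e. either all its factors are well defined or one of them is well
   defined and equal to 0. *)
Definition do_defined D f X v : Prop :=
  {ae @lebesgueV R V, forall w, let u := fix_on X v w in
     (forall i, i \notin X -> cond_defined f (Pa D i) u) \/
     (exists i, [/\ i \notin X, cond_defined f (Pa D i) u &
                    cond_density f [set i]%SET (Pa D i) u = 0%R])}.

Definition adjustment f X Y Z v : \bar R :=
  if Z == finset.set0 then (cond_density f Y X v)%:E
  else int_over Z (fun u =>
         (cond_density f Y (X :|: Z)%SET u * fine (marginal f Z u))%:E) v.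

(* The integrand f(y | x, z) f(z) is well defined for almost every z, at
   x = v_X; for Z empty, f(z) = 1 and this says that f(y | x) is. *)
Definition adjustment_defined f X Z v : Prop :=
  {ae @lebesgueV R V, forall w, let u := fix_on X v w in
     marginal f Z u = 0 \/ cond_defined f (X :|: Z)%SET u}.

End densities.

(** * Identifiability and adjustment *)

Section identification.
Variables (R : realType) (V : finType).
Implicit Types (G : mixed_graph V) (X Y Z : {set V}).

(* f1 = f2 = f in the definition of identifiability; f_k being consistent with
   D_k is what gives a meaning to the interventional density. *)
Definition identifiable G X Y : Prop :=
  ~ exists (D1 D2 : mixed_graph V) (f : valuation R V -> R),
      [/\ represented G D1, represented G D2,
          density f /\ consistent G f,
          dag_consistent D1 f /\ dag_consistent D2 f
        & ~ {ae @lebesgueV R V, forall v,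
               do_defined D1 f X v -> do_defined D2 f X v ->
               do_density D1 f X Y v = do_density D2 f X Y v}].

Definition adjustment_set G X Y Z : Prop :=
  [/\ [disjoint X & Y], [disjoint X & Z], [disjoint Y & Z]
    & forall (f : valuation R V -> R) (D : mixed_graph V),
        density f -> consistent G f ->
        represented G D -> dag_consistent D f ->
        {ae @lebesgueV R V, forall v,
           do_defined D f X v -> adjustment_defined f X Z v ->
           do_density D f X Y v = adjustment f X Y Z v}].

End identification.

(* Main.v *)
Require Import Defs.
From mathcomp Require Import all_boot all_order all_algebra.
From mathcomp Require Import all_classical all_reals all_analysis.
From mathcomp Require Import measurable_realfun zify ring lra.
Import Defs.
Set Implicit Arguments.
Unset Strict Implicit.
Unset Printing Implicit Defensive.
Import Order.TTheory GRing.Theory Num.Theory.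
Import numFieldNormedType.Exports HBNNSimple.

(** Both claims rest on a graphical criterion, [no_undirected_start]: no DAG of
    [G] contains a directed path X -> b -> ... -> Y whose first edge is
    undirected in G.

    The criterion is sufficient.  Any two DAGs of [G] are linked, inside [G],
    by reversals of covered edges ([covered_reversal_ind], after Chickering).
    In the truncated factorisation of f(y | do(x)) over a DAG only the factors
    of the ancestors of Y, in the DAG without X, matter: the other factors
    integrate to 1, one sink at a time ([reduce]).  Reversing a covered edge
    a -> b away from X trades f(a | p) f(b | a, p) for f(b | p) f(a | b, p), two
    products with the same value.  Reversing a covered edge at X changes the
    factors of X and of a neighbour of X, and the criterion says that the
    neighbour is not an ancestor of Y.  So f(y | do(x)) is the same for all
    DAGs of [G] ([computes_represented]).  As f may vanish, the argument keeps
    track of where the truncated product is well defined.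

    Some DAG of [G] has Pa(X, G) as its set of parents of X ([represented_Pa],
    a form of Meek's completeness theorem): it is built by removing sinks, and
    X can be kept until none of its edges is undirected, because a simplicial
    sink with an undirected edge is never the only one
    ([another_simplicial_sink]).  For this DAG the truncated product is f
    divided by f(x | pa(x)), so that f(y | do(x)) is the adjustment formula for
    Pa(X, G) ([do_density_adjustment]).

    The criterion is necessary.  Let D1 in [G] contain the path
    X -> b -> ... -> Y with X - b undirected in G, and let D2 in [G] contain
    b -> X.  Take a positive density in which each node of the path depends on
    its predecessor and on nothing else.  It factorises over D1, hence over D2;
    f(y | do(x)) varies with x when computed in D1, but not in D2
    ([do_density_differ]).  All the conditional densities are well defined
    almost everywhere, so that the effect is not identifiable, and no
    adjustment formula can agree with both DAGs.

    The existence of an adjustment set is not used to derive identifiability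
    directly: an adjustment formula can be undefined where the interventional
    densities are defined.  Both are compared with the criterion instead. *)

(** * Acyclicity *)

Section ranks.
Variable V : finType.
Implicit Types G D : mixed_graph V.

Lemma adjacent_sym G : symmetric (adjacent G).
Proof. by move=> x y; rewrite /adjacent line_sym orbCA. Qed.

Lemma arrow_adj G x y : arrow G x y -> adjacent G x y.
Proof. by rewrite /adjacent => ->. Qed.

Lemma line_adj G x y : line G x y -> adjacent G x y.
Proof. by rewrite /adjacent => ->; rewrite !orbT. Qed.

Lemma arrowxx G x : arrow G x x = false.
Proof. by apply/negP => h; have := one_edge h; rewrite h. Qed.

Lemma adjxx G x : adjacent G x x = false.
Proof. by rewrite /adjacent arrowxx line_irr. Qed.

Lemma mixed_graph_eq G D : arrow G =2 arrow D -> line G =2 line D -> G = D.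
Proof.
case: G D => a l s i o [a' l' s' i' o'] /= ea el.
have Ea : a = a' by apply/funext => x; apply/funext => y.
have El : l = l' by apply/funext => x; apply/funext => y.
subst a' l'; congr MixedGraph; exact: Prop_irrelevance.
Qed.

(** Acyclicity is witnessed by a rank function that increases along arrows; the
    number of ancestors is one. *)
Lemma pdagP G :
  pdag G <-> exists r : V -> nat, forall x y, arrow G x y -> (r x < r y)%N.
Proof.
split=> [pG|[r rP] x y p /and3P[xp _ /eqP <-]]; last first.
  have rle : (r x <= r (last x p))%N.
    elim: p x xp => [|z p IH] x //= /andP[xz zp].
    exact: leq_trans (ltnW (rP _ _ xz)) (IH _ zp).
  by apply/negP => /rP; rewrite ltnNge rle.
exists (fun x => #|[set w | connect (arrow G) w x]%SET|) => x y xy.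
apply: proper_card; apply/properP; split.
  apply/fintype.subsetP => w; rewrite !inE => wx.
  exact: connect_trans wx (connect1 xy).
exists y; rewrite !inE ?connect0//; apply/negP => /connectP[p pp Ex].
move: xy; rewrite Ex; case/shortenP: pp => q qq uq _ xy.
by have := pG y (last y q) q; rewrite /causal_path qq uq eqxx xy => /(_ isT).
Qed.

End ranks.

(** * Covered edge reversals *)

Section reversal.
Variable V : finType.
Implicit Types G D : mixed_graph V.

(** The arrow [a -> b] is covered in [D], that is, its ends have the same other
    parents, and [D'] has the parent sets of [D] with this arrow reversed. *)
Definition covered_reversal D D' (a b : V) : Prop :=
  [/\ arrow D a b, Pa D b = (a |: Pa D a)%SET, Pa D' a = (b |: Pa D a)%SET,
      Pa D' b = Pa D a & forall i, i != a -> i != b -> Pa D' i = Pa D i].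

Lemma dag_adj D x y : dag D -> adjacent D x y = arrow D x y || arrow D y x.
Proof. by move=> [_ nl]; rewrite /adjacent (negPf (nl _ _)) orbF. Qed.

Lemma dag_asym D x y : arrow D x y -> arrow D y x = false.
Proof. by move=> /one_edge/andP[/negPf]. Qed.

Section construction.
Variables (D : mixed_graph V) (a b : V).
Hypotheses (dD : dag D) (ab : arrow D a b) (cov : Pa D b = (a |: Pa D a)%SET).

Let rarrow x y :=
  if (x == b) && (y == a) then true
  else if (x == a) && (y == b) then false else arrow D x y.

Let neq_ab : a != b.
Proof. by apply/eqP => eab; move: ab; rewrite eab arrowxx. Qed.

Let nba : (b == a) = false. Proof. by rewrite eq_sym; exact: negbTE. Qed.

Let rline (x y : V) := false.
Let rline_sym : symmetric rline. Proof. by []. Qed.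
Let rline_irr : irreflexive rline. Proof. by []. Qed.
Let r_one_edge x y : rarrow x y -> ~~ rarrow y x && ~~ rline x y.
Proof.
rewrite /rarrow andbT; case: (eqVneq x b) => [->|xb] /=.
  case: (eqVneq y a) => [->|ya] /=; first by rewrite nba andbF.
  by rewrite nba/= andbF => /dag_asym ->.
case: (eqVneq x a) => [->|xa] /=; last by rewrite !andbF => /dag_asym ->.
case: (eqVneq y b) => [->|yb] //= /dag_asym ->.
by case: ifP.
Qed.

(** The DAG [D] with the arrow [a -> b] reversed. *)
Definition reverse_arrow := MixedGraph rline_sym rline_irr r_one_edge.

Lemma reverse_covered : covered_reversal D reverse_arrow a b.
Proof.
have ba := dag_asym ab.
split=> //.
- apply/setP => z; rewrite !inE /= /rarrow eqxx andbT.
  by case: (eqVneq z b) => //= _; rewrite (negPf neq_ab) andbF.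
- apply/setP => z; move/setP/(_ z): cov; rewrite !inE /= /rarrow eqxx andbT.
  rewrite nba andbF.
  by case: (eqVneq z a) => [->|_]; rewrite ?arrowxx.
- move=> i /negPf ia /negPf ib; apply/setP => z.
  by rewrite !inE /= /rarrow ia ib !andbF.
Qed.

Lemma reverse_dag : dag reverse_arrow.
Proof.
split=> //; apply/pdagP; have [/pdagP[r rP] _] := dD.
(* The new rank doubles the old one and puts b just before a. *)
exists (fun u => if u == b then (r a).*2.+1 else (r u).*2.+2) => x y /=.
rewrite /rarrow; have rab := rP _ _ ab.
case: (eqVneq x b) => [->|xb] /=.
  case: (eqVneq y a) => [->|ya] /=; first by rewrite (negPf neq_ab); lia.
  rewrite nba /= => by'.
  have := rP _ _ by'; case: eqVneq by' => [->|_ _]; first by rewrite arrowxx.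
  lia.
case: (eqVneq y b) => [->|yb] /=.
  rewrite andbT; case: eqVneq => // xa xb'.
  have : x \in Pa D b by rewrite inE.
  by rewrite cov !inE (negPf xa)/= => /rP; lia.
by rewrite andbF => /rP; lia.
Qed.

Lemma reverse_adj : adjacent reverse_arrow =2 adjacent D.
Proof.
move=> x y; rewrite (dag_adj _ _ dD) (dag_adj _ _ reverse_dag) /= /rarrow.
case: (boolP ((x == b) && (y == a))) => [/andP[/eqP-> /eqP->]|n1].
  by rewrite ab orbT.
case: (boolP ((x == a) && (y == b))) => [/andP[/eqP-> /eqP->]|n2].
  by rewrite !eqxx ab.
by rewrite (andbC (y == b)) (negPf n2) (andbC (y == a)) (negPf n1).
Qed.

End construction.

Lemma collider_pa D x c y : unshielded_collider D x c y =
  [&& x != y, x \in Pa D c, y \in Pa D c & ~~ adjacent D x y].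
Proof. by rewrite !inE. Qed.

Lemma covered_reversal_collider D D' a b : dag D -> covered_reversal D D' a b ->
  adjacent D' =2 adjacent D ->
  forall x c y, unshielded_collider D' x c y = unshielded_collider D x c y.
Proof.
move=> dD [ab Pb P'a P'b P'] adj x c y; rewrite !collider_pa adj.
case: (eqVneq x y) => //= xy.
have adjb z : z \in Pa D a -> adjacent D z b.
  move=> za; apply: arrow_adj; have : z \in Pa D b by rewrite Pb in_setU1 za orbT.
  by rewrite inE.
have adja z : z \in Pa D a -> adjacent D z a.
  by rewrite inE; exact: arrow_adj.
case: (eqVneq c a) => [->|ca].
  rewrite P'a !in_setU1; case: (eqVneq x b) xy => [->|xb]; case: (eqVneq y b) => [->|yb] //= _.
  - case: (boolP (y \in _)) => // ya; last by rewrite !andbF.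
    by rewrite adjacent_sym adjb//= !andbF.
  - by case: (boolP (x \in _)) => //= xa; rewrite adjb//= !andbF.
case: (eqVneq c b) => [->|cb].
  rewrite P'b Pb !in_setU1; case: (eqVneq x a) xy => [->|xa']; case: (eqVneq y a) => [->|ya'] //= _.
  - rewrite inE arrowxx /=; case: (boolP (y \in _)) => //= ya.
    by rewrite adjacent_sym adja.
  - by case: (boolP (x \in _)) => //= xa; rewrite adja// !andbF.
by rewrite P'.
Qed.

Section chickering.
Variable G : mixed_graph V.

(** The arrows of [D] that are reversed in [D2]. *)
Definition disagree D D2 :=
  [set e : V * V | arrow D e.1 e.2 && arrow D2 e.2 e.1]%SET.

(** The arrow [x -> y] below is covered: [y] has minimal rank among the heads of
    reversed arrows, and [x] maximal rank among the tails of those into [y]. *)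
Lemma covered_edge_exists D D2 : represented G D -> represented G D2 ->
  disagree D D2 != finset.set0 ->
  exists a b, [/\ arrow D a b, arrow D2 b a & Pa D b = (a |: Pa D a)%SET].
Proof.
move=> [dD adjD colD arrD] [dD2 adjD2 colD2 arrD2].
have adjE x y : arrow D x y || arrow D y x = arrow D2 x y || arrow D2 y x.
  by rewrite -!dag_adj// adjD adjD2.
have colE x c y : unshielded_collider D x c y = unshielded_collider D2 x c y.
  by rewrite colD colD2.
have [/pdagP[r rP] _] := dD; have [/pdagP[r2 r2P] _] := dD2.
case/set0Pn => -[a0 b0]; rewrite inE /= => /andP[ab0 ba0].
pose bad y := [exists x, arrow D x y && arrow D2 y x].
have bad0 : bad b0 by apply/existsP; exists a0; rewrite ab0.
case: (arg_minnP r bad0) => y /existsP[x0 bx0] ymin.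
case: (@arg_maxnP _ x0 (fun x => arrow D x y && arrow D2 y x) r bx0) => x /andP[xy yx] xmax.
exists x, y; split=> //; apply/setP => z; rewrite !inE.
have minx u : arrow D u x -> ~~ arrow D2 x u.
  move=> ux; apply/negP => xu; have := ymin x.
  have -> : bad x by apply/existsP; exists u; rewrite ux.
  by move=> /(_ isT); rewrite leqNgt rP.
have minw w u : r w < r y -> arrow D u w -> ~~ arrow D2 w u.
  move=> wy uw; apply/negP => wu; have := ymin w.
  have -> : bad w by apply/existsP; exists u; rewrite uw.
  by move=> /(_ isT); rewrite leqNgt wy.
have D2of u w : arrow D u w -> ~~ arrow D2 w u -> arrow D2 u w.
  by move=> uw /negPf wu; have := adjE u w; rewrite uw wu orbF => <-.
case: (eqVneq z x) => [->|zx] /=; first by rewrite xy.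
apply/idP/idP => [zy|zx'].
- have adjzx : adjacent D z x.
    apply/negPn/negP => nadj; have := colE z y x.
    rewrite /unshielded_collider zx zy xy nadj /= => /esym/and3P[_ xy2 _].
    by rewrite (dag_asym xy2) in yx.
  move: adjzx; rewrite dag_adj// => /orP[//|xz].
  have zr : r z < r y by exact: rP.
  have xz2 : arrow D2 x z by apply: D2of => //; exact: minw.
  have yz2 : arrow D2 y z.
    have := adjE y z; rewrite zy orbT => /esym/orP[//|zy2].
    have := ltn_trans (ltn_trans (r2P _ _ xz2) (r2P _ _ zy2)) (r2P _ _ yx).
    by rewrite ltnn.
  have := xmax z; rewrite zy yz2 => /(_ isT).
  by rewrite /geq/= leqNgt (rP _ _ xz).
- have zx2 : arrow D2 z x by apply: D2of => //; exact: minx.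
  have : adjacent D z y.
    apply/negPn/negP => nadj; have := colE z x y.
    have zyn : z != y.
      by apply/eqP => e; move: zx'; rewrite e (dag_asym xy).
    rewrite /unshielded_collider zyn zx2 yx (dag_asym xy) /= !andbF.
    move: nadj; rewrite !dag_adj// adjE => -> //.
  rewrite dag_adj// => /orP[//|yz].
  have := ltn_trans (ltn_trans (rP _ _ xy) (rP _ _ yz)) (rP _ _ zx').
  by rewrite ltnn.
Qed.

Lemma reverse_represented D D2 a b (ab : arrow D a b)
    (cov : Pa D b = (a |: Pa D a)%SET) :
  represented G D -> represented G D2 -> arrow D2 b a ->
  represented G (reverse_arrow ab).
Proof.
move=> [dD adjD colD arrD] [dD2 adjD2 colD2 arrD2] ba2.
have dR := reverse_dag dD ab cov.
have adjR := reverse_adj dD ab cov.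
split=> //.
- by move=> x y; rewrite adjR.
- move=> x c y; rewrite -colD; apply: covered_reversal_collider => //.
  exact: reverse_covered.
- move=> x y xy; rewrite /=; case: ifP => // _; case: ifP => [/andP[/eqP ex /eqP ey]|_].
    by have := arrD2 _ _ xy; rewrite ex ey (dag_asym ba2).
  exact: arrD.
Qed.

(** Chickering's theorem as an induction principle: a property of DAGs that
    passes through the covered reversals inside [G] is shared by all the DAGs
    of [G].  Each step reverses an arrow on which the current DAG disagrees
    with the target, so the arrows of [G] are never touched. *)
Lemma covered_reversal_ind (P : mixed_graph V -> Prop) D1 D2 :
  represented G D1 -> represented G D2 ->
  (forall D D' a b, represented G D -> represented G D' ->
     covered_reversal D D' a b -> P D -> P D') ->
  P D1 -> P D2.
Proof.
move=> r1 r2 step; have [n] := ubnP #|disagree D1 D2|.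
elim: n D1 r1 => // n IH D1 r1 lt P1.
have [e|ne] := eqVneq (disagree D1 D2) finset.set0.
  suff -> : D2 = D1 by [].
  have [d1 adj1 _ _] := r1; have [d2 adj2 _ _] := r2.
  apply: mixed_graph_eq => x y; last first.
    by rewrite (negPf (d1.2 _ _)) (negPf (d2.2 _ _)).
  have ne u v : arrow D1 u v -> arrow D2 v u = false.
    by move=> uv; move/setP/(_ (u, v)): e; rewrite !inE /= uv.
  have := adj1 x y; rewrite -adj2 !dag_adj//.
  have := ne y x; have := ne x y.
  case: (arrow D1 x y) => [/(_ isT) ->|_]; case: (arrow D1 y x) => [/(_ isT) ->|_] //=.
    by case: (arrow D2 x y).
  by case: (arrow D2 x y).
have [a [b [ab ba cov]]] := covered_edge_exists r1 r2 ne.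
have rR := reverse_represented ab cov r1 r2 ba.
apply: (IH _ rR); last exact: step r1 rR (reverse_covered ab cov) P1.
rewrite -ltnS; apply: leq_trans lt; rewrite ltnS; apply: proper_card.
apply/properP; split.
  apply/fintype.subsetP => -[x y]; rewrite !inE /=.
  case: ifP => [/andP[/eqP-> /eqP->]|_].
    by rewrite (dag_asym ba).
  by case: ifP.
exists (a, b); rewrite !inE /= ?ab ?ba// andbT.
have [e|_] := eqVneq a b; first by have := ab; rewrite {1}e arrowxx.
by rewrite !eqxx.
Qed.

End chickering.
End reversal.

(** * Orienting an MPDAG *)

Section maximal.
Variables (V : finType) (G : mixed_graph V).
Hypothesis mG : mpdag G.
Implicit Types W : {set V}.

(** In the subgraph induced on [W], the node [s] can be the last node of a DAG:
    it has no outgoing arrow, and directing its undirected edges towards it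
    creates no unshielded collider (Dor and Tarsi). *)
Definition simplicial_sink W s : Prop :=
  [/\ s \in W, forall w, w \in W -> ~~ arrow G s w
    & forall y z, y \in W -> z \in W -> line G s y -> adjacent G z s ->
        z != y -> adjacent G z y].

Lemma line_neq x y : line G x y -> x != y.
Proof. by move=> xy; apply/eqP => e; move: xy; rewrite e line_irr. Qed.

Lemma arrow_neq x y : arrow G x y -> x != y.
Proof. by move=> xy; apply/eqP => e; move: xy; rewrite e arrowxx. Qed.

Lemma line_arrow x y : line G x y -> arrow G x y = false.
Proof. by move=> xy; apply/negP => /one_edge; rewrite xy andbF. Qed.

Lemma adj_case x y : adjacent G x y -> [\/ arrow G x y, arrow G y x | line G x y].
Proof. by move=> /or3P. Qed.

(** [ruleA] to [ruleD] restate that the four forbidden subgraphs do not occur: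
    in the first, third and fourth the nonadjacent pair must be adjacent. *)
Lemma ruleA i j k : arrow G k i -> line G i j -> k != j -> adjacent G k j.
Proof.
move=> ki ij kj; have [_ _ /(_ i j k)/andP[nf _] _] := mG.
apply/negPn/negP => nadj; move/negP: nf; apply.
rewrite /forbidden_a ki ij nadj /= !inE !negb_or (line_neq ij).
by rewrite (eq_sym i k) (arrow_neq ki) (eq_sym j k) kj.
Qed.

Lemma ruleB i j k : arrow G i k -> arrow G k j -> line G i j -> False.
Proof.
move=> ik kj ij; have [_ _ /(_ i j k)/andP[_ nf] _] := mG.
move/negP: nf; apply; rewrite /forbidden_b ik kj ij /= !inE !negb_or.
by rewrite (line_neq ij) (arrow_neq ik) (eq_sym j k) (arrow_neq kj).
Qed.

Lemma ruleC i j k l : arrow G k j -> arrow G l j -> line G i j -> line G i k ->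
  line G i l -> k != l -> adjacent G k l.
Proof.
move=> kj lj ij ik il kl; have [_ _ _ /(_ i j k l)/andP[nf _]] := mG.
apply/negPn/negP => nadj; move/negP: nf; apply.
rewrite /forbidden_c kj lj ij ik il nadj /= !inE !negb_or.
rewrite (line_neq ij) (line_neq ik) (line_neq il) kl.
by rewrite (eq_sym j k) (arrow_neq kj) (eq_sym j l) (arrow_neq lj).
Qed.

Lemma ruleD i j k l : arrow G j l -> arrow G l k -> line G i k -> line G i j ->
  line G i l -> j != k -> adjacent G j k.
Proof.
move=> jl lk ik ij il jk; have [_ _ _ /(_ i j k l)/andP[_ nf]] := mG.
apply/negPn/negP => nadj; move/negP: nf; apply.
rewrite /forbidden_d jl lk ik ij il nadj /= !inE !negb_or.
rewrite (line_neq ij) (line_neq ik) (line_neq il) jk.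
by rewrite (arrow_neq jl) (eq_sym k l) (arrow_neq lk).
Qed.

(** The node of [W] of maximal rank in any DAG of [G] is a simplicial sink. *)
Lemma simplicial_sink_exists W x0 : x0 \in W -> exists s, simplicial_sink W s.
Proof.
move=> x0W; have [_ [D [dD adjD colD arrD]] _ _] := mG.
have [/pdagP[r rP] _] := dD.
case: (arg_maxnP r x0W) => s sW max_s; exists s.
have smax w : w \in W -> r w <= r s by exact: max_s.
split=> //.
  by move=> w wW; apply/negP => /arrD/rP; rewrite ltnNge smax.
move=> y z yW zW sy zs zy; apply/negPn/negP => nadj.
have inD u : u \in W -> adjacent G u s -> arrow D u s.
  move=> uW; rewrite -adjD dag_adj// => /orP[//|/rP].
  by rewrite ltnNge smax.
have ys : adjacent G y s by rewrite adjacent_sym line_adj.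
have := colD z s y; rewrite /unshielded_collider zy (inD _ zW zs) (inD _ yW ys).
rewrite adjD nadj => /esym/and4P[_ _ ys' _].
by have := one_edge ys'; rewrite line_sym sy andbF.
Qed.

(** A simplicial sink [s] with an undirected edge [s - y] is not the only
    simplicial sink.  The last clause is what makes the induction on [W] work:
    it is applied in [W] minus [s] to the edge [t - y], and again to an
    undirected edge from a simplicial sink [l] to a node not adjacent to [s]. *)
Lemma another_simplicial_sink W s y : simplicial_sink W s -> y \in W ->
  line G s y -> exists t, [/\ simplicial_sink W t, t != s
    & [|| ~~ adjacent G t s, t == y | arrow G y t]].
Proof.
have [n] := ubnP #|W|; elim: n W s y => // n IH W s y lt ss yW sy.
have [sW sout snb] := ss.
have [[t [tss ts ntadj]]|nosink] := pselect (exists t,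
    [/\ simplicial_sink W t, t != s & ~~ adjacent G t s]).
  by exists t; split=> //; rewrite ntadj.
pose W' := (W :\ s)%SET.
have ltW' : #|W'| < n by rewrite (cardsD1 s W) sW in lt; exact: lt.
have {}IH t z : simplicial_sink W' t -> z \in W' -> line G t z ->
  exists t', [/\ simplicial_sink W' t', t' != t
    & [|| ~~ adjacent G t' t, t' == z | arrow G z t']] by exact: IH.
have sub z : z \in W' -> z \in W /\ z != s.
  by rewrite in_setD1 => /andP[-> ->].
have in' z : z \in W -> z != s -> z \in W' by move=> zW zs; rewrite in_setD1 zs.
have ys : y != s by rewrite eq_sym; exact: line_neq.
have yW' := in' _ yW ys.
have outW' t z : simplicial_sink W' t -> z \in W' -> arrow G t z = false.
  by move=> [_ h _] /h/negPf.
(* A simplicial sink of W' that is not adjacent to s is one of W. *)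
have adjs t : simplicial_sink W' t -> adjacent G t s.
  move=> [tW' tout tnb]; have [tW ts] := sub _ tW'.
  apply/negPn/negP => nadj; apply: nosink; exists t; split=> //; split=> //.
    move=> w wW; have [->|ws] := eqVneq w s; last by apply: tout; exact: in'.
    by apply/negP => /arrow_adj; exact/negP.
  move=> u v uW vW tu vt; apply: tnb => //.
    apply: in' => //; apply/eqP => e; move/negP: nadj; apply.
    by rewrite -e; exact: line_adj.
  apply: in' => //; apply/eqP => e; move/negP: nadj; apply.
  by rewrite -e adjacent_sym.
(* Otherwise y -> t -> s with y - s, the second forbidden subgraph. *)
have lines t : simplicial_sink W' t -> arrow G y t -> line G t s.
  move=> tss yt; have /adj_case[ts|st|//] := adjs _ tss.
    by exfalso; apply: (ruleB yt ts); rewrite line_sym.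
  by have [/sub[tW _] _ _] := tss; rewrite (negPf (sout _ tW)) in st.
have [l [lss ls ly]] : exists l, [/\ simplicial_sink W' l, line G l s
    & (l == y) || arrow G y l].
  have [t tss] := simplicial_sink_exists yW'.
  have [tW' _ _] := tss; have [tW ts] := sub _ tW'.
  have [ety|ty] := eqVneq t y.
    by exists t; split=> //; rewrite ety ?eqxx// line_sym.
  have /adj_case[ty'|yt|lty] : adjacent G t y by exact: snb (adjs _ tss) ty.
  - by rewrite outW' in ty'.
  - by exists t; split=> //; [exact: lines|rewrite yt orbT].
  have [t' [t'ss t't h]] := IH _ _ tss yW' lty.
  have [t'W' _ _] := t'ss; have [t'W t's] := sub _ t'W'.
  case/orP: h => [nadj|h]; last first.
    exists t'; split=> //; case/orP: h => [/eqP->|yt']; first by rewrite line_sym.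
    exact: lines.
  exfalso; move/negP: nadj; apply.
  have [lts|nlts] := boolP (line G t s).
    by apply: snb t't => //; [rewrite line_sym|exact: adjs].
  have [lt's|nlt's] := boolP (line G t' s).
    rewrite adjacent_sym; apply: snb => //; [by rewrite line_sym|exact: adjs|].
    by rewrite eq_sym.
  (* Both t and t' point to s, and y is linked to s, t and t': this is the
     third forbidden subgraph unless t and t' are adjacent. *)
  have into u : simplicial_sink W' u -> ~~ line G u s -> arrow G u s.
    move=> uss nl; have /adj_case[//|su|lus] := adjs _ uss.
      by have [/sub[uW _] _ _] := uss; rewrite (negPf (sout _ uW)) in su.
    by rewrite lus in nl.
  have [->|t'y] := eqVneq t' y; first by rewrite adjacent_sym line_adj.
  have /adj_case[t'y'|yt'|lt'y] : adjacent G t' y by exact: snb (adjs _ t'ss) t'y.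
  - by rewrite outW' in t'y'.
  - by rewrite lines in nlt's.
  - apply: (@ruleC y s) t't => //; rewrite ?into// line_sym//.
have [lW' lout lnb] := lss; have [lW lns] := sub _ lW'.
(* l is a simplicial sink of W unless one of its neighbours z is not adjacent
   to s; then l - z, and the induction hypothesis for that edge yields a
   contradiction. *)
have [nb|] := pselect (forall z, z \in W' -> adjacent G z l -> adjacent G z s).
  exists l; split=> //; last by rewrite ly orbT.
  split=> //.
    move=> w wW; have [->|ws] := eqVneq w s; first by rewrite line_arrow.
    by apply: lout; exact: in'.
  move=> u v uW vW lu vl vu; have [eus|us] := eqVneq u s.
    by rewrite eus; apply: nb => //; apply: in' => //; rewrite -eus.
  have [evs|vs] := eqVneq v s; last by apply: lnb => //; exact: in'.
  rewrite evs adjacent_sym; apply: nb; first exact: in'.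
  by rewrite adjacent_sym line_adj.
move=> /existsNP[z /not_implyP[zW' /not_implyP[zl /negP nzs]]].
have [zW zs] := sub _ zW'.
have lz : line G l z.
  case/adj_case: zl => [zl|lz|]; last by rewrite line_sym.
    by move/negP: nzs; case; exact: ruleA zl ls zs.
  by rewrite outW' in lz.
have [t [tss tl h]] := IH _ _ lss zW' lz.
have [tW' _ _] := tss; have [tW ts] := sub _ tW'.
have atl : adjacent G t l.
  by apply: snb => //; [rewrite line_sym|exact: adjs].
rewrite atl /= in h; exfalso; move/negP: nzs; apply.
case/orP: h => [/eqP <-|zt]; first exact: adjs.
have /adj_case[ts'|st|lts] := adjs _ tss.
- have llt : line G l t.
    case/adj_case: atl => [tl'|lt'|]; last by rewrite line_sym.
      by rewrite outW' in tl'.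
    by rewrite outW' in lt'.
  exact: ruleD zt ts' ls lz llt zs.
- by rewrite (negPf (sout _ tW)) in st.
- exact: ruleA zt lts zs.
Qed.

(** An order of [W] in which each node is a simplicial sink of the nodes up to
    it, and in which [X] precedes the nodes to which it is linked: simplicial
    sinks are removed one at a time, [X] only when it has no undirected edge
    left. *)
Lemma sink_order (X : V) W : exists r : V -> nat,
  [/\ {in W &, injective r},
      forall s, s \in W ->
        simplicial_sink [set w in W | (r w <= r s)%N]%SET s
    & X \in W -> forall b, b \in W -> line G X b -> (r X < r b)%N].
Proof.
have [n] := ubnP #|W|; elim: n W => // n IH W lt.
have [->|/set0Pn[w0 w0W]] := eqVneq W finset.set0.
  by exists (fun=> 0); split=> [x y||]; rewrite ?inE// => s; rewrite inE.
have [t tss tX] : exists2 t, simplicial_sink W t &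
    t = X -> forall b, b \in W -> ~~ line G X b.
  have [t tss] := simplicial_sink_exists w0W.
  have [etX|tX] := eqVneq t X; last by exists t => // e; rewrite e eqxx in tX.
  have [h|] := pselect (forall b, b \in W -> ~~ line G X b); first by exists t.
  move=> /existsNP[b /not_implyP[bW /negP/negPn Xb]].
  rewrite etX in tss; have [u [uss uX _]] := another_simplicial_sink tss bW Xb.
  by exists u => // e; rewrite e eqxx in uX.
have [tW _ _] := tss.
have [|r [rinj rss rX]] := IH (W :\ t)%SET.
  by rewrite (cardsD1 t W) tW in lt; exact: lt.
pose m := (\max_(i : V) r i).+1.
have rm i : r i < m by rewrite ltnS; exact: leq_bigmax.
pose r' i := if i == t then m else r i.
have r't : r' t = m by rewrite /r' eqxx.
have r'n i : i != t -> r' i = r i by rewrite /r' => /negPf ->.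
have inWt i : i \in W -> i != t -> i \in (W :\ t)%SET.
  by move=> iW it; rewrite in_setD1 it.
exists r'; split.
- move=> x y xW yW; have [->|xt] := eqVneq x t; have [->|yt] := eqVneq y t => //.
  + by rewrite r't r'n// => e; have := rm y; rewrite -e ltnn.
  + by rewrite r't r'n// => e; have := rm x; rewrite -e ltnn.
  + by rewrite !r'n//; apply: rinj; exact: inWt.
- move=> s sW; have [->|st] := eqVneq s t.
    suff -> : [set w in W | r' w <= r' t]%SET = W by [].
    apply/setP => w; rewrite inE r't; case: (boolP (w \in W)) => //= _.
    by have [->|wt] := eqVneq w t; rewrite ?r't ?leqnn// r'n// ltnW ?rm.
  suff -> : [set w in W | r' w <= r' s]%SET = [set w in W :\ t | r w <= r s]%SET.
    by apply: rss; exact: inWt.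
  apply/setP => w; rewrite !inE (r'n s)//; have [->|wt] := eqVneq w t.
    by rewrite r't leqNgt rm andbF.
  by rewrite r'n.
- move=> XW b bW Xb; have [ebt|bt] := eqVneq b t.
    rewrite ebt r't r'n ?rm// -ebt; exact: line_neq.
  have [eX|Xt] := eqVneq X t; first by have := tX (esym eX) _ bW; rewrite Xb.
  by rewrite !r'n//; apply: rX => //; exact: inWt.
Qed.

Section orient.
Variable r : V -> nat.
Hypothesis rinj : injective r.

Let oarrow x y := adjacent G x y && (r x < r y).
Let oline (x y : V) := false.
Let oline_sym : symmetric oline. Proof. by []. Qed.
Let oline_irr : irreflexive oline. Proof. by []. Qed.
Let o_one_edge x y : oarrow x y -> ~~ oarrow y x && ~~ oline x y.
Proof. by move=> /andP[_ xy]; rewrite /oarrow ltnNge (ltnW xy) andbF. Qed.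

(** All the edges of [G] directed along the rank [r]. *)
Definition orientation := MixedGraph oline_sym oline_irr o_one_edge.

Lemma orientation_represented :
  (forall s, simplicial_sink [set w | (r w <= r s)%N]%SET s) ->
  represented G orientation.
Proof.
move=> ss.
have arr x y : arrow G x y -> arrow orientation x y.
  move=> xy; rewrite /= /oarrow arrow_adj// ltnNge; apply/negP => yx.
  by have [_ /(_ y)] := ss x; rewrite inE yx xy => /(_ isT).
have adj : adjacent orientation =2 adjacent G.
  move=> x y; transitivity (oarrow x y || oarrow y x).
    by rewrite /adjacent /= /oline orbF.
  rewrite /oarrow (adjacent_sym G y x) -andb_orr.
  case: (boolP (adjacent G x y)) => //= xy; rewrite -neq_ltn.
  by apply/negP => /eqP/rinj e; rewrite e adjxx in xy.
split=> //.
  by split=> //; apply/pdagP; exists r => x y /andP[].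
move=> x c y; apply/idP/idP => /and4P[xy xc yc nadj].
  have inc u v : arrow orientation u c -> arrow orientation v c -> u != v ->
      ~~ adjacent G u v -> arrow G u c.
    move=> /andP[uc ruc] /andP[vc rvc] uv nuv; have [_ sout snb] := ss c.
    case/adj_case: (uc) => // [cu|luc].
      by have := sout u; rewrite inE (ltnW ruc) cu => /(_ isT).
    move/negP: nuv; case; rewrite adjacent_sym; apply: snb => //.
    - by rewrite inE ltnW.
    - by rewrite inE ltnW.
    - by rewrite line_sym.
    - by rewrite eq_sym.
  rewrite adj in nadj; apply/and4P; split=> //; first exact: inc xc yc _ _.
  by apply: inc yc xc _ _; [rewrite eq_sym|rewrite adjacent_sym].
by apply/and4P; split=> //; rewrite ?adj//; exact: arr.
Qed.

End orient.

(** The undirected edges at a node can all be directed out of it. *)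
Lemma represented_Pa (X : V) :
  exists2 D, represented G D & Pa D X = Pa G X.
Proof.
have [r [rinj rss rX]] := sink_order X [set: V]%SET.
have {}rinj : injective r by move=> x y; apply: rinj; rewrite inE.
have ss s : simplicial_sink [set w | (r w <= r s)%N]%SET s.
  have := rss s; rewrite inE => /(_ isT).
  by congr simplicial_sink; apply/setP => w; rewrite !inE.
have rep := orientation_represented rinj ss.
exists (orientation r) => //; apply/setP => z; rewrite !inE.
apply/idP/idP => [/andP[zX rzX]|]; last by have [_ _ _] := rep; exact.
case/adj_case: zX => // [Xz|zX].
  have [_ _ _ /(_ _ _ Xz)/andP[_]] := rep.
  by rewrite ltnNge ltnW.
have := rX; rewrite inE => /(_ isT z); rewrite inE line_sym => /(_ isT zX).
by rewrite ltnNge ltnW.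
Qed.

End maximal.

(** * Iterated Lebesgue integrals *)

Local Open Scope ring_scope.

Section iterated.
Variables (R : realType) (V : finType).
Local Open Scope ereal_scope.
Local Notation val := (valuation R V).
Local Notation mu := (@lebesgue_measure R).
Implicit Types (F H : val -> \bar R) (v w : val) (s : seq V).

Lemma measurable_valuation d (T : measurableType d) (h : T -> val) :
  (forall i, measurable_fun setT (fun x => h x i : measurableTypeR R)) ->
  measurable_fun setT h.
Proof.
move=> mh; apply: (@measurability _ _ _ val setT _ (@cylinders R V)) => //.
move=> _ [_ [j [B [mB ->]]] <-]; rewrite setTI.
by have := mh j measurableT _ mB; rewrite setTI.
Qed.

Lemma measurable_coord i :
  measurable_fun [set: val] (fun v => v i : measurableTypeR R).
Proof.
move=> _ B mB; rewrite setTI; apply: sub_sigma_algebra.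
by exists i, B.
Qed.

Lemma measurable_coordT d (T : measurableType d) (h : T -> val) i :
  measurable_fun setT h ->
  measurable_fun setT (fun x => h x i : measurableTypeR R).
Proof. by move=> mh; exact: (measurableT_comp (measurable_coord i) mh). Qed.

Lemma measurable_updT d (T : measurableType d) (h : T -> val) i
    (t : T -> measurableTypeR R) :
  measurable_fun setT h -> measurable_fun setT t ->
  measurable_fun setT (fun x => upd (h x) i (t x)).
Proof.
move=> mh mt; apply: measurable_valuation => j; rewrite /upd.
by case: eqP => // _; exact: measurable_coordT.
Qed.

Lemma measurable_fix_on (X : {set V}) v :
  measurable_fun [set: val] (fun w => fix_on X v w : val).
Proof.
apply: measurable_valuation => j; rewrite /fix_on.
by case: (j \in X) => //; exact: measurable_coord.
Qed.

Lemma updC v i j t u : i != j -> upd (upd v i t) j u = upd (upd v j u) i t.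
Proof.
move=> ij; apply/funext => k; rewrite /upd.
by case: (eqVneq k j) => // ->; rewrite eq_sym (negPf ij).
Qed.

(** Nonnegative measurable functions on the joint values. *)
Definition nnm F := (forall v, 0 <= F v) /\ measurable_fun [set: val] F.

Lemma nnm_upd F v i : nnm F ->
  measurable_fun [set: measurableTypeR R] (fun t => F (upd v i t)).
Proof.
by move=> [_ mF]; apply: (measurableT_comp mF); exact: measurable_updT.
Qed.

Lemma nnm_int_seq s F : nnm F -> nnm (int_seq s F).
Proof.
move=> [F0 mF]; split; first by move=> v; exact: int_seq_ge0.
exact: measurable_int_seq.
Qed.

Lemma nnmM F H : nnm F -> nnm H -> nnm (fun v => F v * H v).
Proof.
move=> [F0 mF] [H0 mH]; split; first by move=> v; exact: mule_ge0.
exact: emeasurable_funM.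
Qed.

Lemma nnm_fin (f : val -> R) : (forall v, (0 <= f v)%R) ->
  measurable_fun setT f -> nnm (EFin \o f).
Proof.
by move=> f0 mf; split; [move=> v; rewrite lee_fin|exact/measurable_EFinP].
Qed.

Lemma nnm_indic (N : set val) : measurable N -> nnm (fun v => (\1_N v)%:E).
Proof.
move=> mN; split; first by move=> v; rewrite lee_fin.
by apply/measurable_EFinP; exact: measurable_indic.
Qed.

(** Tonelli's theorem for two of the coordinates. *)
Lemma int_seq_swap i j s F v : nnm F ->
  int_seq (i :: j :: s) F v = int_seq (j :: i :: s) F v.
Proof.
move=> nF; have [->//|ij] := eqVneq i j.
have [s0 ms] := nnm_int_seq s nF => /=.
have mf : measurable_fun setT
    (fun p : measurableTypeR R * measurableTypeR R =>
       int_seq s F (upd (upd v i p.1) j p.2)).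
  apply: (measurableT_comp ms); apply: measurable_updT; last exact: measurable_snd.
  by apply: measurable_updT => //; exact: measurable_fst.
rewrite (fubini_tonelli _ mf (fun p => s0 _))/=.
by apply: eq_integral => t _; apply: eq_integral => u _; rewrite updC.
Qed.

Lemma int_seq_cat s1 s2 F v : int_seq (s1 ++ s2) F v = int_seq s1 (int_seq s2 F) v.
Proof.
elim: s1 v => //= i s IH v.
by apply: eq_integral => t _; exact: IH.
Qed.

Lemma int_seq_move s1 i s2 F v : nnm F ->
  int_seq (s1 ++ i :: s2) F v = int_seq (i :: s1 ++ s2) F v.
Proof.
move=> nF; elim: s1 v => // j s IH v.
rewrite [RHS]int_seq_swap//=.
by apply: eq_integral => t _; exact: IH.
Qed.

Lemma int_seq_perm s t F v : nnm F -> perm_eq s t -> int_seq s F v = int_seq t F v.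
Proof.
move=> nF; elim: s t v => [|i s IH] t v.
  by rewrite perm_sym => /perm_nilP ->.
move=> pst; have it : i \in t by rewrite -(perm_mem pst) mem_head.
case/splitPr: it pst => t1 t2 pst; rewrite int_seq_move//=.
apply: eq_integral => u _; apply: IH.
by rewrite -(perm_cons i) (permPl pst) perm_catC/= perm_cons perm_catC.
Qed.

Implicit Types (A B C : {set V}).

Lemma int_overU A B F v : nnm F -> [disjoint A & B] ->
  int_over (A :|: B)%SET F v = int_over A (int_over B F) v.
Proof.
move=> nF AB; rewrite /int_over -int_seq_cat; apply: int_seq_perm => //.
apply: uniq_perm; first exact: enum_uniq.
  rewrite cat_uniq !enum_uniq andbT /=; apply/hasPn => i.
  by rewrite !mem_enum; apply: contraTN => iA; rewrite (disjointFr AB).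
by move=> i; rewrite mem_cat !mem_enum finset.in_setU.
Qed.

Lemma int_over0 F : int_over finset.set0 F = F.
Proof. by rewrite /int_over enum_set0. Qed.

Lemma int_over1 i F v : int_over [set i]%SET F v = \int[mu]_t F (upd v i t).
Proof. by rewrite /int_over enum_set1. Qed.

Lemma nnm_int_over A F : nnm F -> nnm (int_over A F).
Proof. exact: nnm_int_seq. Qed.

(** [F v] is a function of the coordinates of [v] in [C]. *)
Definition depends (T : Type) C (F : val -> T) :=
  forall v w, (forall i, i \in C -> v i = w i) -> F v = F w.

Lemma dependsS (T : Type) C B (F : val -> T) : {subset C <= B} ->
  depends C F -> depends B F.
Proof. by move=> CB d v w e; apply: d => i /CB; exact: e. Qed.

Lemma depends_upd (T : Type) C (F : val -> T) v i t : depends C F -> i \notin C ->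
  F (upd v i t) = F v.
Proof.
move=> d iC; apply: d => j jC; rewrite /upd; case: eqP => // e.
by rewrite -e jC in iC.
Qed.

Lemma dependsT (T : Type) (F : val -> T) : depends [set: V]%SET F.
Proof. by move=> v w e; congr F; apply/funext => i; apply: e; rewrite inE. Qed.

Lemma int_seq_depends C s F : depends C F ->
  depends [set i in C | i \notin s]%SET (int_seq s F).
Proof.
move=> dF; elim: s => [|i s IH] v w e /=.
  by apply: dF => j jC; apply: e; rewrite !inE jC.
apply: eq_integral => t _; apply: IH => j; rewrite !inE => /andP[jC js].
rewrite /upd; case: eqVneq => // ji; apply: e.
by rewrite !inE jC negb_or ji.
Qed.

Lemma int_over_depends C A F : depends C F -> depends (C :\: A)%SET (int_over A F).
Proof.
move=> d; apply: dependsS (int_seq_depends d) => i.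
by rewrite !inE mem_enum andbC.
Qed.

Lemma eq_int_seq s F H v :
  (forall w, (forall j, j \notin s -> w j = v j) -> F w = H w) ->
  int_seq s F v = int_seq s H v.
Proof.
elim: s v => [|i s IH] v e /=; first by apply: e.
apply: eq_integral => t _; apply: IH => w ew; apply: e => j.
rewrite inE negb_or => /andP[ji js]; rewrite ew// /upd.
by rewrite (negPf ji).
Qed.

Lemma eq_int_over A F H v :
  (forall w, (forall j, j \notin A -> w j = v j) -> F w = H w) ->
  int_over A F v = int_over A H v.
Proof.
move=> e; apply: eq_int_seq => w ew; apply: e => j jA; apply: ew.
by rewrite mem_enum.
Qed.

Lemma int_seqZ s (c : val -> \bar R) F v : nnm F -> (forall v, 0 <= c v) ->
  (forall i w t, i \in s -> c (upd w i t) = c w) ->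
  int_seq s (fun w => c w * F w) v = c v * int_seq s F v.
Proof.
move=> nF c0; elim: s v => //= i s IH v dc.
under eq_integral => t _.
  rewrite IH ?dc ?mem_head//; last first.
    by move=> j w u js; apply: dc; rewrite inE js orbT.
  over.
rewrite ge0_integralZl//; first by (apply: nnm_upd; exact: nnm_int_seq).
by move=> t _; exact: (nnm_int_seq s nF).1.
Qed.

Lemma int_overZ A C (c : val -> \bar R) F v : nnm F -> (forall v, 0 <= c v) ->
  depends C c -> [disjoint A & C] ->
  int_over A (fun w => c w * F w) v = c v * int_over A F v.
Proof.
move=> nF c0 dc AC; apply: int_seqZ => // i w t; rewrite mem_enum => iA.
by apply: (depends_upd _ _ dc); rewrite (disjointFr AC).
Qed.

Lemma int_seqD s F H v : nnm F -> nnm H ->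
  int_seq s (fun w => F w + H w) v = int_seq s F v + int_seq s H v.
Proof.
move=> nF nH; elim: s v => //= i s IH v.
under eq_integral do rewrite IH.
have [F0 _] := nnm_int_seq s nF; have [H0 _] := nnm_int_seq s nH.
rewrite ge0_integralD//; by (apply: nnm_upd; exact: nnm_int_seq).
Qed.

Lemma le_int_seq s F H v : nnm F -> nnm H -> (forall v, F v <= H v) ->
  int_seq s F v <= int_seq s H v.
Proof.
move=> nF nH FH; elim: s v => //= i s IH v.
apply: ge0_le_integral => //.
- by move=> t _; exact: (nnm_int_seq s nF).1.
- by (apply: nnm_upd; exact: nnm_int_seq).
- by (apply: nnm_upd; exact: nnm_int_seq).
Qed.

Lemma integral_eq0P d (T : measurableType d) (m : {measure set T -> \bar R})
  (h : T -> \bar R) : (forall t, 0 <= h t) -> measurable_fun setT h ->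
  \int[m]_t h t = 0 <-> {ae m, forall t, h t = 0}.
Proof.
move=> h0 mh; have [+ +] := ae_eq_integral_abs m measurableT mh.
under eq_integral do rewrite gee0_abs//.
move=> a b; split => [/a|c]; first by apply: filterS => t /(_ I).
by apply: b; apply: filterS c => t + _.
Qed.

(** [filterS] for the Lebesgue measure on the line, stated for the plain set
    function. *)
Lemma ae_lebesgueS (P Q : measurableTypeR R -> Prop) : (forall t, P t -> Q t) ->
  {ae mu, forall t, P t} -> {ae mu, forall t, Q t}.
Proof.
move=> PQ [N [mN N0 sub]]; exists N; split=> // t nQ; apply: sub => /= Pt.
exact/nQ/PQ.
Qed.

(** A function integrates to 0 exactly when its support does. *)
Lemma int_seq_eq0 s F v : nnm F ->
  int_seq s F v = 0 <-> int_seq s (fun w => (\1_[set w | F w != 0]%classic w)%:E) v = 0.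
Proof.
move=> nF; have nI : nnm (fun w => (\1_[set w | F w != 0]%classic w)%:E).
  apply: nnm_indic; rewrite -[X in measurable X]setTI.
  by apply: measurable_neqe => //; exact: nF.2.
elim: s v => [|i s IH] v /=.
  rewrite indicE; have [e|F0] := eqVneq (F v) 0.
    by rewrite memNset//= e eqxx.
  rewrite mem_set//=; split=> [e|[/eqP]]; first by rewrite e eqxx in F0.
  by rewrite oner_eq0.
have [s0 ms] := nnm_int_seq s nF; have [t0 mt] := nnm_int_seq s nI.
rewrite !integral_eq0P//; first last.
  by (apply: nnm_upd; exact: nnm_int_seq).
  by (apply: nnm_upd; exact: nnm_int_seq).
by split; apply: filterS => t /IH.
Qed.

Lemma integral_gt0 (h : measurableTypeR R -> \bar R) : (forall t, 0 < h t) ->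
  measurable_fun setT h -> 0 < \int[mu]_t h t.
Proof.
move=> h0 mh; rewrite lt0e integral_ge0 ?andbT; last by move=> t _; exact: ltW.
apply/eqP; rewrite integral_eq0P//; last by move=> t; exact: ltW.
move=> [N [mN N0]] sub.
have NT : N = [set: measurableTypeR R]%classic.
  by apply/seteqP; split=> // t _; apply: sub => /= e; have := h0 t; rewrite e ltxx.
have : mu `[0%R, 1%R]%classic <= mu N by apply: le_measure; rewrite ?inE// NT.
by rewrite N0 lebesgue_measure_itv/= lte01 oppr0 adde0 leNgt lte01.
Qed.

Lemma int_seq_gt0 s F v : nnm F -> (forall w, 0 < F w) -> 0 < int_seq s F v.
Proof.
move=> nF F0; elim: s v => //= i s IH v; apply: integral_gt0 => //.
by apply: nnm_upd; exact: nnm_int_seq.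
Qed.

(** * Null sets *)
(** The indicator function of [N]. *)
Definition oneN (N : set val) v : \bar R := (\1_N v)%:E.

Lemma oneN_out N v : ~ N v -> oneN N v = 0.
Proof. by move=> h; rewrite /oneN indicE memNset. Qed.

Lemma oneN_eq0 N v : oneN N v = 0 -> ~ N v.
Proof.
move=> + h; rewrite /oneN indicE mem_set//= => -[/eqP].
by rewrite oner_eq0.
Qed.

Lemma nnm_oneN (N : set val) : measurable N -> nnm (oneN N).
Proof. exact: nnm_indic. Qed.

Lemma int_seq0 s v : int_seq s (fun=> 0) v = 0.
Proof. by elim: s v => //= i s IH v; apply: integral0_eq => t _; exact: IH. Qed.

Lemma int_over_zero A F v : (forall w, F w = 0) -> int_over A F v = 0.
Proof. by move=> F0; rewrite /int_over (eq_int_seq (H := fun=> 0)) ?int_seq0. Qed.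

Lemma int_over_const0 A F v (c : \bar R) : nnm F -> (forall w, F w = c) ->
  int_over A F v = 0 -> c = 0.
Proof.
move=> nF Fc; have [//|c0] := eqVneq c 0.
have Fgt w : 0 < F w by rewrite lt0e Fc c0 -(Fc w) nF.1.
by have := int_seq_gt0 (enum A) v nF Fgt; rewrite /int_over => /[swap] ->; rewrite ltxx.
Qed.

Lemma lebesgueVE (N : set val) : lebesgueV N = int_over [set: V]%SET (oneN N) (fun=> 0%R).
Proof. by []. Qed.

Lemma setTUC A : [set: V]%SET = (A :|: ~: A)%SET.
Proof. by rewrite finset.setUCr. Qed.

Lemma disjC A : [disjoint A & ~: A]%SET.
Proof. by rewrite -setI_eq0 finset.setICr. Qed.

(** Almost all the slices of a null set along the coordinates in [A] are
    null. *)
Lemma ae_slice (N : set val) A : measurable N -> lebesgueV N = 0 ->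
  {ae @lebesgueV R V, forall v, int_over A (oneN N) v = 0}.
Proof.
move=> mN N0; have nN := nnm_oneN mN; have ng := nnm_int_over A nN.
set g := int_over A (oneN N) in ng *.
exists [set v | g v != 0]%classic; split=> //.
- rewrite -[X in measurable X]setTI; apply: measurable_neqe => //; exact: ng.2.
- have mN' : measurable [set v | g v != 0]%classic.
    by rewrite -[X in measurable X]setTI; apply: measurable_neqe => //; exact: ng.2.
  rewrite lebesgueVE (setTUC A) int_overU; [|exact: nnm_oneN|exact: disjC].
  apply: int_over_zero => w; apply/(int_seq_eq0 _ _ ng).
  suff c : forall u u', int_seq (enum (~: A)%SET) g u = int_seq (enum (~: A)%SET) g u'.
    rewrite (c w (fun=> 0%R)); move: N0.
    rewrite lebesgueVE (setTUC A) finset.setUC int_overU//.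
    by rewrite disjoint_sym disjC.
  move=> u u'; apply: (@int_over_depends (~: A)%SET (~: A)%SET g).
    apply: dependsS (int_over_depends (@dependsT _ _)) => i.
    by rewrite !inE andbT.
  by move=> i; rewrite !inE andNb.
by move=> v /= /eqP.
Qed.

Lemma aeP (P : set val) : {ae @lebesgueV R V, forall v, P v} <->
  exists N : set val, [/\ measurable N, lebesgueV N = 0 & forall v, ~ N v -> P v].
Proof.
split=> [[N [mN N0 sub]]|[N [mN N0 sub]]]; exists N; split=> //.
  by move=> v nN; apply: contrapT => nP; apply: nN; exact: sub.
by move=> v /= nP; apply: contrapT => nN; apply: nP; exact: sub.
Qed.

Lemma ae_upd (P : set val) i : {ae @lebesgueV R V, forall v, P v} ->
  {ae @lebesgueV R V, forall v, {ae mu, forall t, P (upd v i t)}}.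
Proof.
move=> /aeP[N [mN N0 sub]]; have nN := nnm_oneN mN.
apply: filterS (ae_slice [set i]%SET mN N0) => v.
rewrite int_over1 integral_eq0P; last 2 first.
- by move=> t; exact: nN.1.
- exact: nnm_upd.
by apply: filterS => t /oneN_eq0/sub.
Qed.

Lemma fix_on_upd (X : {set V}) v w i t : i \notin X ->
  fix_on X v (upd w i t) = upd (fix_on X v w) i t.
Proof.
move=> iX; apply/funext => j; rewrite /fix_on /upd; case: eqVneq => // ->.
by rewrite (negPf iX).
Qed.

Lemma int_seq_fix_on (X : {set V}) s F v w : (forall i, i \in s -> i \notin X) ->
  int_seq s (fun w => F (fix_on X v w)) w = int_seq s F (fix_on X v w).
Proof.
elim: s w => //= i s IH w sX; apply: eq_integral => t _.
rewrite IH; last by move=> j js; apply: sX; rewrite inE js orbT.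
by rewrite fix_on_upd// sX ?mem_head.
Qed.

Lemma int_fix_on (X : {set V}) F v w : nnm F ->
  int_over (~: X)%SET (fun w => F (fix_on X v w)) w = int_over (~: X)%SET F v.
Proof.
move=> nF; rewrite /int_over int_seq_fix_on; last first.
  by move=> i; rewrite mem_enum inE.
apply: (int_over_depends (@dependsT _ F)) => i; rewrite !inE negbK andbT.
by rewrite /fix_on => ->.
Qed.

Lemma measurable_fix_set (X : {set V}) v (N : set val) : measurable N ->
  measurable [set w : val | N (fix_on X v w)]%classic.
Proof.
by move=> mN; have := measurable_fix_on X v measurableT mN; rewrite setTI.
Qed.

Lemma lebesgueV_fix (X : {set V}) v (N : set val) : measurable N ->
  lebesgueV [set w : val | N (fix_on X v w)]%classic = 0 <->
  int_over (~: X)%SET (oneN N) v = 0.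
Proof.
move=> mN; have nN := nnm_oneN mN; have mN' := measurable_fix_set X v mN.
have nN' := nnm_oneN mN'.
rewrite lebesgueVE (setTUC X) int_overU//; last exact: disjC.
have e w : int_over (~: X)%SET (oneN [set w : val | N (fix_on X v w)]%classic) w =
  int_over (~: X)%SET (oneN N) v by exact: (@int_fix_on X (oneN N)).
split=> [h|h].
  exact: int_over_const0 (nnm_int_over _ nN') e h.
by apply: int_over_zero => w; rewrite e h.
Qed.

(** Fubini for properties that hold almost everywhere: for almost every [v],
    they hold at almost every point that agrees with [v] on [X]. *)
Lemma ae_fix_on (X : {set V}) (P : set val) : {ae @lebesgueV R V, forall v, P v} ->
  {ae @lebesgueV R V, forall v, {ae @lebesgueV R V, forall w, P (fix_on X v w)}}.
Proof.
move=> /aeP[N [mN N0 sub]].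
apply: filterS (ae_slice (~: X)%SET mN N0) => v.
move=> /(lebesgueV_fix X v mN) h; apply/aeP; eexists; split; [|exact: h|].
  exact: measurable_fix_set.
by move=> w nN; exact: sub.
Qed.

(** A converse: for almost every [v], if almost all the points that agree with
    [v] on [X] avoid [U], then so does [v] itself. *)
Lemma ae_of_fix_on (X : {set V}) (U : set val) : measurable U ->
  {ae @lebesgueV R V, forall v,
    {ae @lebesgueV R V, forall w, ~ U (fix_on X v w)} -> ~ U v}.
Proof.
move=> mU; pose g := int_over (~: X)%SET (oneN U).
have nU := nnm_oneN mU; have ng : nnm g := nnm_int_over _ nU.
have mg0 : measurable [set v | g v = 0]%classic.
  by rewrite -[X in measurable X]setTI; apply: measurable_eqe => //; exact: ng.2.
pose B := ([set v | g v = 0] `&` U)%classic.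
have mB : measurable B by exact: measurableI.
apply/aeP; exists B; split=> //.
  rewrite lebesgueVE (setTUC X) int_overU; [|exact: nnm_oneN|exact: disjC].
  apply: int_over_zero => w.
  have dg : depends X g.
    apply: dependsS (int_over_depends (@dependsT _ _)) => i.
    by rewrite !inE negbK andbT.
  have [gw|gw] := eqVneq (g w) 0; last first.
    rewrite /int_over (eq_int_seq (H := fun=> 0)) ?int_seq0// => u eu.
    apply: oneN_out => -[/= gu _]; move/eqP: gw; apply.
    rewrite -gu; apply: dg => i iX; rewrite eu// mem_enum inE negbK//.
  apply/eqP; rewrite eq_le (nnm_int_seq _ (nnm_oneN mB)).1 andbT -{1}gw.
  apply: le_int_seq => //; [exact: nnm_oneN|] => u.
  have [Bu|nB] := pselect (B u); last by rewrite oneN_out// nU.1.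
  by rewrite /oneN !indicE !mem_set//; case: Bu.
move=> v nB [N [mN N0 sub]] Uv; apply: nB; split=> //=.
apply/(lebesgueV_fix X v mU); apply/eqP; rewrite eq_le measure_ge0 andbT.
rewrite -N0 le_measure ?inE//; first exact: measurable_fix_set.
by move=> w Uw; apply: sub => /= /(_ Uw).
Qed.

Lemma int_seq_ae_eq (N : set val) s F H v : measurable N -> nnm F -> nnm H ->
  int_seq s (oneN N) v = 0 ->
  (forall w, (forall j, j \notin s -> w j = v j) -> ~ N w -> F w = H w) ->
  int_seq s F v = int_seq s H v.
Proof.
move=> mN nF nH; have nN := nnm_oneN mN.
elim: s v => [|i s IH] v /=; first by move=> /oneN_eq0 nv; apply.
rewrite integral_eq0P; last 2 first.
- by move=> t; exact: (nnm_int_seq s nN).1.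
- by apply: nnm_upd; exact: nnm_int_seq.
move=> z e; apply: ge0_ae_eq_integral => //.
- by apply: nnm_upd; exact: nnm_int_seq.
- by apply: nnm_upd; exact: nnm_int_seq.
- by move=> t _; exact: (nnm_int_seq s nF).1.
- by move=> t _; exact: (nnm_int_seq s nH).1.
apply: filterS z => t zt _; apply: IH => // w ew nw; apply: e => // j.
by rewrite inE negb_or => /andP[ji js]; rewrite ew// /upd (negPf ji).
Qed.

(** An equality that holds almost everywhere on a set [E] can be integrated over
    the coordinates in [A], provided that [E] does not restrict them.  [E] need
    not be measurable. *)
Lemma ae_int_over A (E : val -> Prop) F H : nnm F -> nnm H -> depends (~: A)%SET E ->
  {ae @lebesgueV R V, forall v, E v -> F v = H v} ->
  {ae @lebesgueV R V, forall v, E v -> int_over A F v = int_over A H v}.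
Proof.
move=> nF nH dE /aeP[N [mN N0 sub]].
apply: filterS (ae_slice A mN N0) => v zv Ev.
apply: int_seq_ae_eq zv _ => // w ew nw; apply: sub => //.
by rewrite (dE w v)// => j; rewrite inE => jA; apply: ew; rewrite mem_enum.
Qed.

(** A measurable set is null if all its slices along [A] are. *)
Lemma null_by_slices A (N : set val) : measurable N ->
  (forall w, int_over A (oneN N) w = 0) -> lebesgueV N = 0.
Proof.
move=> mN h; rewrite lebesgueVE (setTUC A) finset.setUC int_overU; last 2 first.
- exact: nnm_oneN.
- by rewrite disjoint_sym disjC.
by apply: int_over_zero => w.
Qed.

Lemma aeV_exists (P : val -> Prop) : {ae @lebesgueV R V, forall v, P v} ->
  exists v, P v.
Proof.
move=> /aeP[N [mN N0 sub]]; apply: contrapT => no.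
have NT w : oneN N w = 1.
  by rewrite /oneN indicE mem_set//; apply: contrapT => /sub Pw; apply: no; exists w.
have := @int_seq_gt0 (enum [set: V]%SET) (oneN N) (fun=> 0%R) (nnm_oneN mN).
rewrite -/(int_over _ _) -lebesgueVE N0 ltxx => h.
by have /h : forall w, 0 < oneN N w by move=> w; rewrite NT.
Qed.

(** * The Lebesgue integral on R^V *)
Lemma int_seq_sum (I : Type) (r : seq I) (F : I -> val -> \bar R) s v :
  (forall k, nnm (F k)) ->
  int_seq s (fun w => \sum_(k <- r) F k w) v = \sum_(k <- r) int_seq s (F k) v.
Proof.
move=> nF; elim: s v => //= i s IH v.
under eq_integral do rewrite IH.
rewrite ge0_integral_sum//.
- by move=> k; apply: nnm_upd; exact: nnm_int_seq.
- by move=> k t _; exact: (nnm_int_seq s (nF k)).1.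
Qed.

Lemma int_seq_monotone (F : (val -> \bar R)^nat) s :
  (forall n, nnm (F n)) -> (forall v, {homo F ^~ v : n m / (n <= m)%N >-> n <= m}) ->
  int_seq s (fun w => limn (F ^~ w)) = fun v => limn (fun n => int_seq s (F n) v).
Proof.
move=> nF hF; elim: s => [|i s IH] //=; apply/funext => v.
under eq_integral do rewrite IH.
rewrite monotone_convergence//.
- by move=> n; apply: nnm_upd; exact: nnm_int_seq.
- by move=> n t _; exact: (nnm_int_seq s (nF n)).1.
- by move=> t _ n m nm; apply: le_int_seq => // w; exact: hF.
Qed.

(** The integral against [lebesgueV] is the iterated integral. *)
Lemma integral_lebesgueV F : nnm F ->
  \int[@lebesgueV R V]_v F v = int_over [set: V]%SET F (fun=> 0%R).
Proof.
move=> nF; have [F0 mF] := nF.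
pose g := nnsfun_approx measurableT mF.
have hg (x : val) : {homo (fun n => g n x) : n m / (n <= m)%N >-> (n <= m)%R}.
  by move=> n m nm; exact/lefP/nd_nnsfun_approx.
have cg (x : val) : ((EFin \o g ^~ x) @ \oo --> F x)%classic by exact: cvg_nnsfun_approx.
rewrite (@nd_ge0_integral_lim _ _ _ _ F g)//.
have FE : F = fun w => limn (fun n => (g n w)%:E).
  by apply/funext => w; apply/esym/cvg_lim => //; exact: cg.
have ng n : nnm (EFin \o g n) by apply: nnm_fin => // w.
rewrite {1}FE /int_over (int_seq_monotone (F := fun n => EFin \o g n))//.
rewrite (_ : _ \o _ =
  (fun n => int_seq (enum [set: V]%SET) (EFin \o g n) (fun=> 0%R)))//.
apply/funext => n /=.
rewrite sintegralE fsbig_finite//.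
transitivity (int_seq (enum [set: V]%SET) (fun w => \sum_(y <- finmap.enum_fset (fset_set (range (g n))))
   (y%:E * oneN (g n @^-1` [set y])%classic w)) (fun=> 0%R)); last first.
  apply: eq_int_seq => w _ /=; rewrite (fimfunE (g n)) fsbig_finite//.
  by rewrite -sumEFin; apply: eq_bigr => y _; rewrite EFinM.
have mN y : measurable (g n @^-1` [set y])%classic by exact: measurable_sfunP.
have neg y : (y < 0)%R -> (g n @^-1` [set y] = set0)%classic.
  move=> y0; rewrite -subset0 => w /= e; have : (0 <= g n w)%R by [].
  by rewrite e leNgt y0.
have o0 w : oneN set0 w = 0 by rewrite oneN_out.
rewrite int_seq_sum; last first.
  move=> y; have [y0|y0] := leP 0%R y.
    by apply: (@nnmM (cst y%:E)); [exact: (@nnm_fin (cst y))|exact: nnm_oneN].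
  rewrite neg//; split; first by move=> w; rewrite o0 mule0.
  rewrite (_ : (fun w => _) = cst 0)//; apply/funext => w; exact: etrans (congr1 _ (o0 w)) (mule0 _).
apply: eq_bigr => y _; have [y0|y0] := leP 0%R y.
  by rewrite (@int_seqZ _ (cst y%:E))//; exact: nnm_oneN.
rewrite neg// measure0 mule0; apply/esym/(@int_over_zero [set: V]%SET) => w.
by rewrite o0 mule0.
Qed.
End iterated.

(** * Marginals of a density *)

Section marginals.
Variables (R : realType) (V : finType) (f : valuation R V -> R).
Hypothesis df : density f.
Local Open Scope ereal_scope.
Local Notation val := (valuation R V).
Local Notation mu := (@lebesgue_measure R).
Implicit Types (A B P X Y : {set V}) (v w : val).

Lemma nnm_density : nnm (EFin \o f).
Proof. by have [mf f0 _] := df; exact: nnm_fin. Qed.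

Lemma nnm_marginal A : nnm (marginal f A).
Proof. exact: nnm_int_over nnm_density. Qed.

Lemma marginal_ge0 A v : 0 <= marginal f A v.
Proof. exact: (nnm_marginal A).1. Qed.

Lemma marginal_depends A : depends A (marginal f A).
Proof.
apply: dependsS (int_over_depends (@dependsT R V _ _)) => i.
by rewrite !inE negbK andbT.
Qed.

Lemma marginalT v : marginal f [set: V]%SET v = (f v)%:E.
Proof. by rewrite /marginal finset.setCT int_over0. Qed.

Lemma marginalS A B v : A \subset B ->
  marginal f A v = int_over (B :\: A)%SET (marginal f B) v.
Proof.
move=> AB; rewrite /marginal -int_overU; [|exact: nnm_density|]; last first.
  by rewrite -setI_eq0; apply/eqP/setP => i; rewrite !inE; case: (i \in B); rewrite ?andbF.
congr int_over; apply/setP => i; rewrite !inE.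
by have := fintype.subsetP AB i; case: (i \in A) => [->|]; case: (i \in B).
Qed.

Lemma marginal0 v : marginal f finset.set0 v = 1.
Proof.
rewrite (@marginal_depends finset.set0 v (fun=> 0%R)); last by move=> i; rewrite inE.
have [_ _ <-] := df; rewrite integral_lebesgueV; last exact: nnm_density.
by rewrite /marginal finset.setC0.
Qed.

Lemma int_over_marginal A v : int_over A (marginal f A) v = 1.
Proof. by rewrite -(marginal0 v) (marginalS v (finset.sub0set A)) finset.setD0. Qed.

Lemma ae_marginal_fin A : {ae @lebesgueV R V, forall v, marginal f A v < +oo}.
Proof.
pose N := [set v : val | marginal f A v = +oo]%classic.
have [m0 mm] := nnm_marginal A.
have mN : measurable N.
  rewrite -[X in measurable X]setTI; apply: measurable_eqe => //.
exists N; split=> //; last first.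
  move=> v /= /negP; rewrite -leNgt leye_eq => /eqP; exact.
apply: (@null_by_slices _ _ A) => // w; have nN := nnm_oneN mN.
have le : int_over A (fun v => +oo * oneN N v) w <= 1.
  rewrite -(int_over_marginal A w); apply: le_int_seq.
  - by apply: (@nnmM _ _ (cst +oo) _ _ nN); split=> [v|]; [exact: leey|exact: measurable_cst].
  - exact: nnm_marginal.
  move=> v; have [Nv|nN'] := pselect (N v); last by rewrite oneN_out// mule0.
  by rewrite Nv leey.
rewrite /int_over (@int_seqZ _ _ _ (cst +oo)) //= in le.
apply/eqP/negPn/negP => ne; move: le.
by rewrite gt0_mulye ?leye_eq// lt0e ne (nnm_int_seq _ nN).1.
Qed.

Lemma ae_marginal0S A B : A \subset B ->
  {ae @lebesgueV R V, forall v, marginal f A v = 0 -> marginal f B v = 0}.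
Proof.
move=> AB.
pose N := ([set v : val | marginal f A v = 0] `&` [set v | marginal f B v != 0])%classic.
have [a0 ma] := nnm_marginal A; have [b0 mb] := nnm_marginal B.
have mNb : measurable [set v : val | marginal f B v != 0]%classic.
  by rewrite -[X in measurable X]setTI; apply: measurable_neqe.
have mN : measurable N.
  apply: measurableI => //.
  by rewrite -[X in measurable X]setTI; apply: measurable_eqe.
exists N; split=> //; last first.
  by move=> v /= /not_implyP[av bv]; split=> //; apply/eqP.
apply: (@null_by_slices _ _ (B :\: A)) => // w; have nN := nnm_oneN mN.
have [aw|aw] := eqVneq (marginal f A w) 0; last first.
  rewrite /int_over (eq_int_seq (H := fun=> 0)) ?int_seq0// => u eu.
  apply: oneN_out => -[/= au _]; move/eqP: aw; apply; rewrite -au.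
  by apply: marginal_depends => i iA; rewrite eu// mem_enum inE iA.
have := aw; rewrite (marginalS _ AB) => /(int_seq_eq0 _ _ (nnm_marginal B)) z.
apply/eqP; rewrite eq_le (nnm_int_over _ nN).1 andbT -{1}z.
apply: le_int_seq => //; first exact: nnm_oneN.
move=> v; have [[Na Nb]|nN'] := pselect (N v).
  by rewrite /oneN !indicE !mem_set.
by rewrite (oneN_out nN') lee_fin.
Qed.

(** All the marginals at [v] are finite, and they vanish along with the
    marginals of fewer variables.  Almost every [v] is regular. *)
Definition regular v : Prop :=
  (forall A, marginal f A v < +oo) /\
  (forall A B, A \subset B -> marginal f A v = 0 -> marginal f B v = 0).

Lemma ae_regular : {ae @lebesgueV R V, forall v, regular v}.
Proof.
have h1 : {ae @lebesgueV R V, forall v, forall A, marginal f A v < +oo}.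
  by apply: filter_forall => A; exact: ae_marginal_fin.
have h2 : {ae @lebesgueV R V, forall v, forall A B, A \subset B ->
    marginal f A v = 0 -> marginal f B v = 0}.
  apply: filter_forall => A; apply: filter_forall => B.
  case: (boolP (A \subset B)) => AB; last by apply: aeW => v.
  by apply: filterS (ae_marginal0S AB) => v h _.
by apply: filterS2 h1 h2 => v a b; split.
Qed.

(** The marginal f(a) as a real number. *)
Definition rm A v : R := fine (marginal f A v).

Lemma rm_ge0 A v : (0 <= rm A v)%R.
Proof. exact/fine_ge0/marginal_ge0. Qed.

Lemma regular_marginal v A : regular v -> marginal f A v = (rm A v)%:E.
Proof.
by move=> [fin _]; rewrite /rm fineK// ge0_fin_numE// marginal_ge0.
Qed.

Lemma regular_cond_defined v A : regular v -> cond_defined f A v = (0 < rm A v)%R.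
Proof.
by move=> rv; rewrite /cond_defined regular_marginal// ltry andbT lte_fin.
Qed.

Lemma regular_rm0 v A B : regular v -> A \subset B -> rm A v = 0%R -> rm B v = 0%R.
Proof.
move=> rv AB a0; have [_ /(_ _ _ AB)] := rv.
by rewrite !regular_marginal// a0 => /(_ erefl) [].
Qed.

Lemma regular_rm_gt0 v A B : regular v -> A \subset B -> (0 < rm B v)%R -> (0 < rm A v)%R.
Proof.
move=> rv AB b0; rewrite lt0r rm_ge0 andbT; apply/eqP => a0.
by move: b0; rewrite (regular_rm0 rv AB a0) ltxx.
Qed.

Lemma cond_densityE A B v : cond_density f A B v = (rm (A :|: B)%SET v / rm B v)%R.
Proof. by []. Qed.

Lemma cond_density_ge0 A B v : (0 <= cond_density f A B v)%R.
Proof. by rewrite cond_densityE divr_ge0// rm_ge0. Qed.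

Lemma cond_density_depends A B : depends (A :|: B)%SET (cond_density f A B).
Proof.
move=> v w e; rewrite !cond_densityE /rm (marginal_depends e).
by rewrite (@marginal_depends B v w)// => i iB; apply: e; rewrite inE iB orbT.
Qed.

Lemma cond_defined_depends B : depends B (cond_defined f B).
Proof. by move=> v w e; rewrite /cond_defined (marginal_depends e). Qed.

Lemma measurable_rm A : measurable_fun setT (rm A).
Proof.
by have [_ m] := nnm_marginal A; exact: (measurableT_comp (fine_measurable _) m).
Qed.

Lemma measurable_rmV A : measurable_fun setT (fun v => (rm A v)^-1)%R.
Proof.
rewrite (_ : (fun v => _) = fun v => powR (rm A v) (-1))%R; last first.
  by apply/funext => v; rewrite powR_inv1// rm_ge0.
exact: (measurableT_comp (measurable_powR _) (measurable_rm A)).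
Qed.

Lemma measurable_cond_density A B : measurable_fun setT (cond_density f A B).
Proof. exact: measurable_funM (measurable_rm _) (measurable_rmV B). Qed.

Lemma measurable_cond_defined B : measurable_fun setT (cond_defined f B).
Proof.
have [_ m] := nnm_marginal B.
by apply: measurable_and; exact: measurable_fun_lte.
Qed.

(** A conditional density integrates to 1 where it is well defined, and to 0
    elsewhere. *)
Lemma integral_cond_density i P v : i \notin P ->
  \int[mu]_t (cond_density f [set i]%SET P (upd v i t))%:E = (cond_defined f P v)%:R%:E.
Proof.
move=> iP.
have mP t : marginal f P (upd v i t) = marginal f P v.
  exact: depends_upd (@marginal_depends _) iP.
have eP : marginal f P v = \int[mu]_t marginal f (i |: P)%SET (upd v i t).
  rewrite (@marginalS P (i |: P)%SET); last exact: finset.subsetUr.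
  rewrite -int_over1; congr int_over; apply/setP => j; rewrite !inE.
  by case: eqVneq => [->|]; rewrite ?iP//= andNb.
have nM := nnm_marginal (i |: P)%SET.
have ge0 t : 0 <= marginal f (i |: P)%SET (upd v i t) by exact: marginal_ge0.
have mM : measurable_fun setT (fun t : measurableTypeR R => marginal f (i |: P)%SET (upd v i t)).
  exact: nnm_upd.
case: (boolP (cond_defined f P v)) => [/andP[P0 Poo]|nd].
  have fin : marginal f P v \is a fin_num by rewrite ge0_fin_numE// ltW.
  have aefin : {ae mu, forall t : measurableTypeR R,
      marginal f (i |: P)%SET (upd v i t) \is a fin_num}.
    have := integrable_ae measurableT (f := fun t => marginal f (i |: P)%SET (upd v i t)) (mu := mu).
    case.
      apply/integrableP; split=> //.
      by under eq_integral do rewrite gee0_abs//; rewrite -eP.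
    by move=> N [mN N0 sub]; exists N; split=> // t /= nf; apply: sub => /= /(_ I).
  have r0 : (0 < fine (marginal f P v))%R by rewrite fine_gt0// P0.
  transitivity (\int[mu]_t (marginal f (i |: P)%SET (upd v i t) * (rm P v)^-1%:E)).
    apply: ge0_ae_eq_integral => //.
    - apply/measurable_EFinP.
      have mc := measurable_cond_density [set i]%SET P.
      apply: (measurableT_comp mc); exact: measurable_updT.
    - exact: emeasurable_funM.
    - by move=> t _; rewrite lee_fin cond_density_ge0.
    - by move=> t _; rewrite mule_ge0// lee_fin invr_ge0 rm_ge0.
    by apply: filterS aefin => t ft _; rewrite cond_densityE EFinM /rm mP fineK.
  rewrite ge0_integralZr//; last by rewrite lee_fin invr_ge0 rm_ge0.
  by rewrite -eP -(fineK fin) -EFinM /rm divff// gt_eqF.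
have r0 : fine (marginal f P v) = 0%R.
  move: nd; rewrite negb_and -!leNgt leye_eq => /orP[p0|/eqP ->//].
  suff -> : marginal f P v = 0 by [].
  by apply/eqP; rewrite eq_le p0 marginal_ge0.
apply: integral0_eq => t _; rewrite cond_densityE /rm mP r0 invr0 mulr0//.
Qed.

End marginals.

(** * Truncated factorisations *)

Section truncated.
Variables (R : realType) (V : finType) (f : valuation R V -> R).
Hypothesis df : density f.
Local Open Scope ereal_scope.
Local Notation val := (valuation R V).
Local Notation mu := (@lebesgue_measure R).
Implicit Types (A B P X Y : {set V}) (v w : val) (D : mixed_graph V).

(** f(v_i | pa(v_i, D)), and where it is well defined. *)
Definition factor D i v : R := cond_density f [set i]%SET (Pa D i) v.
Definition fdef D i v : bool := cond_defined f (Pa D i) v.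

Lemma factor_ge0 D i v : (0 <= factor D i v)%R.
Proof. exact: cond_density_ge0. Qed.

Lemma factor_depends D i : depends (i |: Pa D i)%SET (factor D i).
Proof. exact: cond_density_depends. Qed.

Lemma fdef_depends D i : depends (Pa D i) (fdef D i).
Proof. exact: cond_defined_depends. Qed.

(** The product of the factors of the nodes in [A]. *)
Definition fprod D A v : R := (\prod_(i in A) factor D i v)%R.

Lemma fprod_ge0 D A v : (0 <= fprod D A v)%R.
Proof. by apply: prodr_ge0 => i _; exact: factor_ge0. Qed.

Lemma measurable_fprod D A : measurable_fun setT (fprod D A).
Proof.
rewrite (_ : fprod D A = fun v => \prod_(i <- enum A) factor D i v)%R; last first.
  by apply/funext => v; rewrite /fprod big_enum.
by apply: measurable_prod => i _; exact: measurable_cond_density.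
Qed.

Lemma nnm_fprod D A : nnm (EFin \o fprod D A).
Proof. by apply: nnm_fin; [exact: fprod_ge0|exact: measurable_fprod]. Qed.

(** The product over [A] is well defined at [v]: all its factors are, or one of
    them is well defined and equal to 0. *)
Definition well_defined D A v : bool :=
  all (fun i => fdef D i v) (enum A)
  || has (fun i => fdef D i v && (factor D i v == 0%R)) (enum A).

Lemma well_definedP D A v : reflect
  ((forall i, i \in A -> fdef D i v) \/
   (exists i, [/\ i \in A, fdef D i v & factor D i v = 0%R]))
  (well_defined D A v).
Proof.
apply: (iffP orP) => -[h|h]; [left|right|left|right].
- by move=> i iA; apply: (allP h); rewrite mem_enum.
- by case/hasP: h => i; rewrite mem_enum => iA /andP[fi /eqP ci]; exists i.
- by apply/allP => i; rewrite mem_enum; exact: h.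
- by case: h => i [iA fi ci]; apply/hasP; exists i; rewrite ?mem_enum// fi ci/=.
Qed.

Lemma measurable_all (T : Type) (p : T -> val -> bool) (s : seq T) :
  (forall i, measurable_fun setT (p i)) ->
  measurable_fun setT (fun v => all (fun i => p i v) s).
Proof.
move=> mp; elim: s => [|i s IH] /=; first exact: measurable_cst.
exact: measurable_and.
Qed.

Lemma measurable_has (T : Type) (p : T -> val -> bool) (s : seq T) :
  (forall i, measurable_fun setT (p i)) ->
  measurable_fun setT (fun v => has (fun i => p i v) s).
Proof.
move=> mp; elim: s => [|i s IH] /=; first exact: measurable_cst.
exact: measurable_or.
Qed.

Lemma measurable_well_defined D A : measurable_fun setT (well_defined D A).
Proof.
have mf i : measurable_fun setT (fdef D i) by exact: measurable_cond_defined.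
apply: measurable_or; first exact: measurable_all.
apply: measurable_has => i; apply: measurable_and => //.
by apply: measurable_fun_eqr => //; exact: measurable_cond_density.
Qed.

Lemma do_jointE D X v : do_joint D f X v = fprod D (~: X)%SET v.
Proof. by rewrite /do_joint /fprod; apply: eq_bigl => i; rewrite inE. Qed.

Lemma do_definedE D X v : do_defined D f X v <->
  {ae @lebesgueV R V, forall w, well_defined D (~: X)%SET (fix_on X v w)}.
Proof.
split; apply: filterS => w /=.
  move=> h; apply/well_definedP; case: h => [h|[i [iX di ci]]].
    by left=> i; rewrite inE; exact: h.
  by right; exists i; rewrite inE.
move=> /well_definedP[h|[i [iX di ci]]].
  by left=> i iX; apply: h; rewrite inE.
by right; exists i; rewrite inE in iX.
Qed.

(** [do_defined] at [v] is about almost all the points that agree with [v] on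
    [X]; almost every [v] can be taken to be one of them. *)
Lemma ae_do_defined D X :
  {ae @lebesgueV R V, forall v, do_defined D f X v -> well_defined D (~: X)%SET v}.
Proof.
pose U := [set v : val | ~~ well_defined D (~: X)%SET v]%classic.
have mU : measurable U.
  have := measurable_well_defined D (~: X)%SET measurableT (Y := [set false]%classic).
  rewrite setTI => /(_ I); congr measurable.
  by apply/seteqP; split=> v; rewrite /U /=; case: (well_defined D (~: X)%SET v).
apply: filterS (ae_of_fix_on X mU) => v h /do_definedE dd.
apply/negPn/negP => nU; apply: h nU => /=.
by apply: filterS dd => w; rewrite /U /= => ->.
Qed.

Lemma do_defined_depends D X : depends X (do_defined D f X).
Proof.
move=> v w e; rewrite /do_defined.
suff -> : fix_on X v = fix_on X w by [].
apply/funext => u; apply/funext => i; rewrite /fix_on.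
by case: (boolP (i \in X)) => // /e.
Qed.

(** The product over [A], integrated over all the nodes of [A] but those in
    [Y].  For [A] the complement of [X] this is f(y | do(x)). *)
Definition doA D A Y : val -> \bar R := int_over (A :\: Y)%SET (EFin \o fprod D A).

Lemma do_densityE D X Y v : do_density D f X Y v = doA D (~: X)%SET Y v.
Proof.
rewrite /do_density /doA finset.setCU finset.setDE; congr int_over.
by apply/funext => w /=; rewrite do_jointE.
Qed.

(** [A] is disjoint from [X] and contains the parents outside [X] of its
    nodes. *)
Definition ancestral D X A : bool :=
  (A \subset ~: X)%SET && [forall i in A, Pa D i \subset (A :|: X)%SET].

Lemma ancestralP D X A : reflect
  ((forall i, i \in A -> i \notin X) /\
   (forall i j, i \in A -> arrow D j i -> j \notin X -> j \in A))
  (ancestral D X A).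
Proof.
apply: (iffP andP) => [[/fintype.subsetP AX /forall_inP h]|[AX h]]; split.
- by move=> i /AX; rewrite inE.
- move=> i j iA ji jX; have := fintype.subsetP (h _ iA) j.
  by rewrite !inE ji (negPf jX) orbF => /(_ isT).
- by apply/fintype.subsetP => i /AX; rewrite inE.
- apply/forall_inP => i iA; apply/fintype.subsetP => j; rewrite !inE => ji.
  by case: (boolP (j \in X)); rewrite ?orbT// orbF => /(h _ _ iA ji).
Qed.

Lemma ancestralI D X A B : ancestral D X A -> ancestral D X B ->
  ancestral D X (A :&: B)%SET.
Proof.
move=> /ancestralP[AX hA] /ancestralP[BX hB]; apply/ancestralP; split.
  by move=> i; rewrite inE => /andP[/AX].
move=> i j; rewrite !inE => /andP[iA iB] ji jX.
by rewrite (hA _ _ iA ji)// (hB _ _ iB ji).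
Qed.

Lemma ancestralC D X : ancestral D X (~: X)%SET.
Proof. by apply/ancestralP; split=> [i|i j]; rewrite !inE. Qed.

Lemma Pa_irr D i : i \notin Pa D i.
Proof. by rewrite inE arrowxx. Qed.

(** Integrating out the last node leaves the product of the other factors where
    the factor of that node is well defined, and 0 elsewhere. *)
Lemma int_factor D A i v : i \notin A -> (forall j, j \in A -> i \notin Pa D j) ->
  int_over [set i]%SET (EFin \o fprod D (i |: A)%SET) v =
  (fprod D A v * (fdef D i v)%:R)%:E.
Proof.
move=> iA iPa; have fj t j : j \in A -> factor D j (upd v i t) = factor D j v.
  move=> jA; apply: depends_upd (@factor_depends D j) _.
  rewrite in_setU1 negb_or iPa// andbT; apply/eqP => e.
  by rewrite e jA in iA.
rewrite int_over1 /=.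
under eq_integral => t _.
  rewrite /fprod big_setU1//= EFinM.
  under eq_bigr => j jA do rewrite fj//.
  rewrite -/(fprod D A v) muleC; over.
rewrite ge0_integralZl//.
- by rewrite integral_cond_density ?Pa_irr// EFinM.
- apply/measurable_EFinP.
  have mc := measurable_cond_density df [set i]%SET (Pa D i).
  by apply: (measurableT_comp mc); exact: measurable_updT.
- by move=> t _; rewrite lee_fin factor_ge0.
- by rewrite lee_fin fprod_ge0.
Qed.

Section reduction.
Variables (X Y : {set V}) (E : val -> Prop).
Hypothesis dE : depends X E.

(** A node [i] without children in [A] can be dropped.  [E] stands for a set of
    values of [X]. *)
Lemma reduce1 D A i : ancestral D X A -> ancestral D X (i |: A)%SET ->
  i \notin A -> Y \subset A ->
  {ae @lebesgueV R V, forall v, E v -> well_defined D (i |: A)%SET v} ->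
  {ae @lebesgueV R V, forall v, E v -> well_defined D A v} /\
  {ae @lebesgueV R V, forall v, E v -> doA D (i |: A)%SET Y v = doA D A Y v}.
Proof.
move=> /ancestralP[AX hA] /ancestralP[iAX hiA] iA YA wd.
have iX : i \notin X by apply: iAX; rewrite !inE eqxx.
have iPa j : j \in A -> i \notin Pa D j.
  move=> jA; rewrite inE; apply/negP => ij.
  by have := hA _ _ jA ij iX; apply/negP.
have Ei v t : E (upd v i t) = E v by exact: depends_upd dE iX.
have fdi v t : fdef D i (upd v i t) = fdef D i v.
  exact: depends_upd (@fdef_depends D i) (Pa_irr _ _).
have fdj v t j : j \in A -> fdef D j (upd v i t) = fdef D j v.
  by move=> jA; apply: depends_upd (@fdef_depends D j) (iPa _ jA).
have fj v t j : j \in A -> factor D j (upd v i t) = factor D j v.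
  move=> jA; apply: depends_upd (@factor_depends D j) _.
  rewrite in_setU1 negb_or iPa// andbT; apply/eqP => e.
  by rewrite e jA in iA.
(* Where the factor of i is undefined, another factor must be 0; where it is
   defined, it is nonzero for some value of v_i, and for that value the product
   is well defined thanks to the other factors. *)
have key : {ae @lebesgueV R V, forall v, E v ->
    well_defined D A v /\ (fdef D i v \/ fprod D A v = 0%R)}.
  apply: filterS (ae_upd i wd) => v h Ev.
  have {}h : {ae mu, forall t, well_defined D (i |: A)%SET (upd v i t)}.
    by apply: ae_lebesgueS h => t; apply; rewrite Ei.
  have notae : ~ {ae mu, forall t, False}.
    move=> hF; have := @integral_gt0 R (fun=> 1) (fun=> lte01).
    rewrite (_ : \int[mu]_t 1 = 0) ?ltxx; first by move=> /(_ (measurable_cst _)).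
    by apply/integral_eq0P => //; apply: ae_lebesgueS hF.
  have [fi|nfi] := boolP (fdef D i v).
    split; last by left.
    have [t [wdt ft]] : exists t, well_defined D (i |: A)%SET (upd v i t) /\
        factor D i (upd v i t) != 0%R.
      apply: contrapT => no.
      have : \int[mu]_t (factor D i (upd v i t))%:E = 0.
        apply/integral_eq0P.
        - by move=> t; rewrite lee_fin factor_ge0.
        - apply/measurable_EFinP.
          have mc := measurable_cond_density df [set i]%SET (Pa D i).
          by apply: (measurableT_comp mc); exact: measurable_updT.
        apply: ae_lebesgueS h => t wdt; congr EFin; apply/eqP/negPn/negP => ne.
        by apply: no; exists t.
      rewrite integral_cond_density ?Pa_irr// -/(fdef D i v) fi => -[] /eqP.
      by rewrite oner_eq0.
    apply/well_definedP; case/well_definedP: wdt => [all|[j [jiA dj cj]]].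
      by left=> j jA; rewrite -(fdj _ t)//; apply: all; rewrite in_setU1 jA orbT.
    right; exists j; move: jiA; rewrite in_setU1 => /orP[/eqP e|jA].
      by rewrite e in cj; rewrite cj eqxx in ft.
    by rewrite -(fdj _ t)// -(fj _ t).
  have [t /well_definedP wdt] : exists t, well_defined D (i |: A)%SET (upd v i t).
    by apply: contrapT => no; apply: notae; apply: ae_lebesgueS h => t wdt; apply: no; exists t.
  case: wdt => [all|[j [jiA dj cj]]].
    by have := all i; rewrite in_setU1 eqxx fdi (negPf nfi) => /(_ isT).
  have jA : j \in A.
    move: jiA; rewrite in_setU1 => /orP[/eqP e|//].
    by rewrite e fdi (negPf nfi) in dj.
  rewrite fdj// in dj; rewrite fj// in cj; split.
    by apply/well_definedP; right; exists j.
  by right; rewrite /fprod (bigD1 j)//= cj mul0r.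
split; first by apply: filterS key => v h /h[].
have iY : i \notin Y by apply: contra iA; exact: fintype.subsetP YA i.
rewrite /doA; set B := (A :\: Y)%SET.
have -> : ((i |: A) :\: Y = B :|: [set i])%SET.
  apply/setP => j; rewrite !inE; case: (eqVneq j i) => [->|] /=.
    by rewrite iY orbT.
  by rewrite orbF.
have dB : [disjoint B & [set i]%SET].
  by rewrite disjoint_sym disjoints1 !inE (negPf iA) andbF.
have {}key : {ae @lebesgueV R V, forall v, E v ->
    int_over [set i]%SET (EFin \o fprod D (i |: A)%SET) v = (fprod D A v)%:E}.
  apply: filterS key => v h /h[_ {}h]; rewrite int_factor//.
  by case: h => ->; rewrite ?mulr1// mul0r.
have dE' : depends (~: B)%SET E.
  apply: dependsS dE => j jX; rewrite !inE negb_and; apply/orP; right.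
  by apply/negP => /AX; rewrite jX.
have := ae_int_over (nnm_int_over [set i]%SET (nnm_fprod D (i |: A)%SET))
  (nnm_fprod D A) dE' key.
apply: filterS => v h Ev; rewrite int_overU//; last exact: nnm_fprod.
exact: h.
Qed.

(** The nodes outside a smaller ancestral set are dropped one sink at a time. *)
Lemma reduce D A B : dag D -> ancestral D X A -> ancestral D X B ->
  A \subset B -> Y \subset A ->
  {ae @lebesgueV R V, forall v, E v -> well_defined D B v} ->
  {ae @lebesgueV R V, forall v, E v -> well_defined D A v} /\
  {ae @lebesgueV R V, forall v, E v -> doA D B Y v = doA D A Y v}.
Proof.
move=> [/pdagP[r rP] _] aA + + YA; have [n] := ubnP #|B :\: A|%SET.
elim: n B => // n IH B lt aB AB wd.
have [e|/set0Pn[i0 i0BA]] := eqVneq (B :\: A)%SET finset.set0.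
  have -> : A = B.
    by apply/eqP; rewrite finset.eqEsubset AB -finset.setD_eq0 e eqxx.
  by split=> //; apply: aeW.
case: (arg_maxnP r i0BA) => i /finset.setDP[iB iA] imax.
have eB : B = (i |: (B :\ i))%SET by rewrite finset.setD1K.
have sA : (A \subset B :\ i)%SET.
  apply/fintype.subsetP => j jA; rewrite !inE (fintype.subsetP AB)// andbT.
  by apply/eqP => e; rewrite -e jA in iA.
have aB' : ancestral D X (B :\ i)%SET.
  have /ancestralP[BX hB] := aB; have /ancestralP[AX hA] := aA.
  apply/ancestralP; split=> [j|j k]; rewrite !inE => /andP[ji jB]; first exact: BX.
  move=> kj kX; rewrite (hB _ _ jB kj)// andbT; apply/eqP => e; rewrite e in kj kX *.
  have [jA|jA] := boolP (j \in A); first by rewrite (hA _ _ jA kj) in iA.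
  have : j \in (B :\: A)%SET by rewrite inE jA jB.
  move=> /imax.
  by rewrite /geq/= leqNgt (rP _ _ kj).
have [||||wd' e'] := @reduce1 D (B :\ i)%SET i aB'.
- by rewrite -eB.
- by rewrite !inE eqxx.
- exact: fintype.subset_trans YA sA.
- by rewrite -eB.
have [|wd'' e''] := IH (B :\ i)%SET _ aB' sA wd'.
  move: lt; rewrite (cardsD1 i) !inE iA iB/= add1n ltnS.
  by congr (_ < _)%N; congr #|pred_of_set _|; apply/setP => j; rewrite !inE andbCA.
split=> //; rewrite -eB in e'.
by apply: filterS2 e' e'' => v h h' Ev; rewrite h// h'.
Qed.

(** Both sides agree with the intersection of the two ancestral sets. *)
Lemma doA_ancestral D A B : dag D -> ancestral D X A -> ancestral D X B ->
  Y \subset A -> Y \subset B ->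
  {ae @lebesgueV R V, forall v, E v -> well_defined D A v} ->
  {ae @lebesgueV R V, forall v, E v -> well_defined D B v} ->
  {ae @lebesgueV R V, forall v, E v -> doA D A Y v = doA D B Y v}.
Proof.
move=> dD aA aB YA YB wA wB; have aI := ancestralI aA aB.
have YI : (Y \subset A :&: B)%SET by rewrite finset.subsetI YA.
have [_ eA] := reduce dD aI aA (finset.subsetIl _ _) YI wA.
have [_ eB] := reduce dD aI aB (finset.subsetIr _ _) YI wB.
by apply: filterS2 eA eB => v h h' Ev; rewrite h// h'.
Qed.

End reduction.
End truncated.

(** * Covered reversals and truncated factorisations *)

Section covered.
Variables (R : realType) (V : finType) (f : valuation R V -> R).
Hypothesis df : density f.
Local Open Scope ereal_scope.
Local Notation val := (valuation R V).
Implicit Types (A B P X Y : {set V}) (v w : val).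
Variables (D D' : mixed_graph V) (a b : V).
Hypothesis cr : covered_reversal D D' a b.

Lemma covered_neq : a != b.
Proof. by case: cr => ab _ _ _ _; apply/eqP => e; move: ab; rewrite e arrowxx. Qed.

Lemma covered_Pa i : i != a -> i != b -> Pa D' i = Pa D i.
Proof.
by move=> ia ib; have [_ _ _ _ h] := cr; exact: h.
Qed.

Lemma covered_factor i : i != a -> i != b -> factor f D' i = factor f D i.
Proof. by move=> ia ib; rewrite /factor covered_Pa. Qed.

Lemma covered_fdef i : i != a -> i != b -> fdef f D' i = fdef f D i.
Proof. by move=> ia ib; rewrite /fdef covered_Pa. Qed.

(** A covered reversal does not affect the factors of the other nodes. *)

Section outside.
Variable A : {set V}.
Hypotheses (aA : a \notin A) (bA : b \notin A).

Let neq i : i \in A -> i != a /\ i != b.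
Proof. by move=> iA; split; apply: contraTneq iA => ->. Qed.

Lemma covered_ancestral_out X : ancestral D X A = ancestral D' X A.
Proof.
rewrite /ancestral; congr andb; apply: eq_forallb => i.
case: (boolP (i \in A)) => // /neq[ia ib] /=; by rewrite covered_Pa.
Qed.

Lemma covered_fprod_out : fprod f D' A = fprod f D A.
Proof.
apply/funext => v; apply: eq_bigr => i /neq[ia ib].
by rewrite covered_factor.
Qed.

Lemma covered_well_defined_out v : well_defined f D' A v = well_defined f D A v.
Proof.
rewrite /well_defined; congr orb.
  apply: eq_in_all => i; rewrite mem_enum => /neq[ia ib].
  by rewrite covered_fdef.
apply: eq_in_has => i; rewrite mem_enum => /neq[ia ib].
by rewrite covered_fdef// covered_factor.
Qed.

End outside.

Section pointwise.
Variable v : val.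
Hypothesis rv : regular f v.

Let p := Pa D a.
Let rp := rm f p v.
Let ra := rm f (a |: p)%SET v.
Let rb := rm f (b |: p)%SET v.
Let rab := rm f (b |: (a |: p))%SET v.

Let fa : factor f D a v = (ra / rp)%R. Proof. by []. Qed.
Let fb : factor f D b v = (rab / ra)%R.
Proof. by rewrite /factor cond_densityE; case: cr => _ -> _ _ _. Qed.
Let f'a : factor f D' a v = (rab / rb)%R.
Proof. by rewrite /factor cond_densityE; case: cr => _ _ -> _ _; rewrite finset.setUCA. Qed.
Let f'b : factor f D' b v = (rb / rp)%R.
Proof. by rewrite /factor cond_densityE; case: cr => _ _ _ -> _. Qed.
Let da : fdef f D a v = (0 < rp)%R.
Proof. exact: regular_cond_defined. Qed.
Let db : fdef f D b v = (0 < ra)%R.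
Proof. by rewrite /fdef regular_cond_defined//; case: cr => _ -> _ _ _. Qed.
Let d'a : fdef f D' a v = (0 < rb)%R.
Proof. by rewrite /fdef regular_cond_defined//; case: cr => _ _ -> _ _. Qed.
Let d'b : fdef f D' b v = (0 < rp)%R.
Proof. by rewrite /fdef regular_cond_defined//; case: cr => _ _ _ -> _. Qed.

Let ra_ab : ra = 0%R -> rab = 0%R.
Proof. by apply: regular_rm0 => //; exact: finset.subsetUr. Qed.
Let rb_ab : rb = 0%R -> rab = 0%R.
Proof.
by apply: regular_rm0 => //; rewrite finset.setUCA; exact: finset.subsetUr.
Qed.
Let ra_p : (0 < ra)%R -> (0 < rp)%R.
Proof. by apply: regular_rm_gt0 => //; exact: finset.subsetUr. Qed.
Let cases (A : {set V}) : (0 < rm f A v)%R \/ rm f A v = 0%R.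
Proof.
have := rm_ge0 df A v; rewrite le_eqVlt => /orP[/eqP <-|]; by [right|left].
Qed.

(** f(a | p) f(b | a, p) = f(b | p) f(a | b, p), also where some of these
    factors are 0 or not well defined. *)
Lemma covered_fprod A : a \in A -> b \in A -> fprod f D' A v = fprod f D A v.
Proof.
move=> aA bA; have split D0 : fprod f D0 A v = (factor f D0 a v *
    (factor f D0 b v * \prod_(i in A | (i != a) && (i != b)) factor f D0 i v))%R.
  rewrite /fprod (bigD1 a)//=; congr (_ * _)%R.
  rewrite (bigD1 b)/=; last by rewrite bA eq_sym covered_neq.
  congr (_ * _)%R.
  by apply: eq_bigl => i; rewrite andbA.
rewrite (split D') (split D) (mulrA (factor f D' a v)) (mulrA (factor f D a v)); congr (_ * _)%R; last first.
  by apply: eq_bigr => i /andP[iA /andP[ia ib]]; rewrite covered_factor.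
rewrite fa fb f'a f'b.
have [a0|a0] := cases (a |: p)%SET; have [b0|b0] := cases (b |: p)%SET;
  rewrite -/ra in a0; rewrite -/rb in b0.
- by rewrite [RHS]mulrC !mulrA !divfK// gt_eqF.
- by rewrite rb_ab// !mul0r mulr0.
- by rewrite ra_ab// !mul0r mulr0.
- by rewrite rb_ab// !mul0r mulr0.
Qed.

Let factor0 (x y : R) : (0 < y)%R -> (x / y)%R = 0%R -> x = 0%R.
Proof.
by move=> y0 /eqP; rewrite mulf_eq0 invr_eq0 (gt_eqF y0) orbF => /eqP.
Qed.

Lemma covered_well_defined A : a \in A -> b \in A ->
  well_defined f D A v -> well_defined f D' A v.
Proof.
move=> aA bA /well_definedP wd; apply/well_definedP.
have useb : (0 < rp)%R -> rab = 0%R ->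
    exists i, [/\ i \in A, fdef f D' i v & factor f D' i v = 0%R].
  move=> p0 ab0; have [b0|b0] := cases (b |: p)%SET; rewrite -/rb in b0.
    by exists a; rewrite aA d'a f'a ab0 mul0r.
  by exists b; rewrite bA d'b f'b b0 mul0r.
case: wd => [all|[i [iA di ci]]].
  have := all _ aA; have := all _ bA; rewrite da db => a0 p0.
  have [b0|b0] := cases (b |: p)%SET; rewrite -/rb in b0; last first.
    by right; apply: useb => //; exact: rb_ab.
  left=> i iA; have [->|ia] := eqVneq i a; first by rewrite d'a.
  have [->|ib] := eqVneq i b; first by rewrite d'b.
  by rewrite covered_fdef//; exact: all.
right; have [ia|ia] := eqVneq i a.
  rewrite ia da in di; rewrite ia fa in ci; apply: useb => //.
  by apply: ra_ab; exact: factor0 di ci.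
have [ib|ib] := eqVneq i b.
  rewrite ib db in di; rewrite ib fb in ci; apply: useb; first exact: ra_p.
  exact: factor0 di ci.
by exists i; rewrite covered_fdef// covered_factor.
Qed.

(** If f(a | p) is well defined, then either it is 0 or f(b | a, p) is well
    defined too. *)
Lemma covered_well_defined_add A : a \in A ->
  well_defined f D A v -> well_defined f D (b |: A)%SET v.
Proof.
move=> aA /well_definedP[all|[i [iA di ci]]]; apply/well_definedP; last first.
  by right; exists i; rewrite in_setU1 iA orbT.
have := all _ aA; rewrite da => p0.
have [a0|a0] := cases (a |: p)%SET; rewrite -/ra in a0.
  left=> i; rewrite in_setU1 => /orP[/eqP ->|]; last exact: all.
  by rewrite db.
by right; exists a; rewrite in_setU1 aA orbT da fa a0 mul0r.
Qed.

End pointwise.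
End covered.

Section identification.
Variables (R : realType) (V : finType) (f : valuation R V -> R).
Hypothesis df : density f.
Local Open Scope ereal_scope.
Local Notation val := (valuation R V).
Variables (X Y : {set V}) (E : val -> Prop).
Hypothesis dE : depends X E.
Implicit Types (A B : {set V}) (v w : val) (D : mixed_graph V).

(** On [E], [phi] is almost everywhere the well-defined integral of the factors
    of [D] over some ancestral set containing [Y]. *)
Definition computes D (phi : val -> \bar R) : Prop := exists A : {set V},
  [/\ ancestral D X A, Y \subset A,
      {ae @lebesgueV R V, forall v, E v -> well_defined f D A v}
    & {ae @lebesgueV R V, forall v, E v -> phi v = doA f D A Y v}].

(** Covered reversals preserve [computes]; when one end is in [X], neither end
    may be needed for [Y]. *)
Lemma computes_covered D D' a b phi : dag D -> dag D' ->
  covered_reversal D D' a b ->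
  (a \in X \/ b \in X ->
     exists A, [/\ ancestral D X A, Y \subset A, a \notin A & b \notin A]) ->
  computes D phi -> computes D' phi.
Proof.
move=> dD dD' cr out [A [aA YA wd ephi]].
have outside A' : ancestral D X A' -> Y \subset A' -> a \notin A' -> b \notin A' ->
    computes D' phi.
  move=> aA' YA' nA' nB'.
  have aI := ancestralI aA aA'.
  have YI : (Y \subset A :&: A')%SET by rewrite finset.subsetI YA.
  have [wI eI] := reduce df dE dD aI aA (finset.subsetIl _ _) YI wd.
  have nI : a \notin (A :&: A')%SET by rewrite inE (negPf nA') andbF.
  have nI' : b \notin (A :&: A')%SET by rewrite inE (negPf nB') andbF.
  exists (A :&: A')%SET; split=> //.
  - by rewrite -(covered_ancestral_out cr).
  - by apply: filterS wI => v h Ev; rewrite (covered_well_defined_out f cr)// h.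
  - apply: filterS2 ephi eI => v h h' Ev; rewrite h// h'//.
    by rewrite /doA (covered_fprod_out f cr).
have [/out[A' [aA' YA' nA nB]]|nX] := pselect (a \in X \/ b \in X).
  exact: outside aA' YA' nA nB.
have aX : a \notin X by apply/negP => h; apply: nX; left.
have bX : b \notin X by apply/negP => h; apply: nX; right.
have [iaA|naA] := boolP (a \in A); last first.
  apply: (outside A) => //; apply/negP => bA.
  have /ancestralP[_ h] := aA; have [ab _ _ _ _] := cr.
  by rewrite (h _ _ bA ab aX) in naA.
pose B := (b |: A)%SET.
have [ab Pb P'a P'b P'] := cr.
have /ancestralP[AX hA] := aA.
have aB : ancestral D X B.
  apply/ancestralP; split=> [i|i j]; rewrite !in_setU1 => /orP[/eqP ->|iA] //.
  - exact: AX.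
  - have -> : arrow D j b = (j \in Pa D b) by rewrite inE.
    rewrite Pb in_setU1 inE => /orP[/eqP -> _|ja jX]; first by rewrite iaA orbT.
    by rewrite (hA _ _ iaA ja)// orbT.
  - by move=> ji jX; rewrite (hA _ _ iA ji)// orbT.
have aB' : ancestral D' X B.
  have /ancestralP[BX hB] := aB; apply/ancestralP; split=> // i j iB.
  have -> : arrow D' j i = (j \in Pa D' i) by rewrite inE.
  have [->|ia] := eqVneq i a.
    rewrite P'a in_setU1 inE => /orP[/eqP -> _|ja jX]; first by rewrite in_setU1 eqxx.
    by rewrite in_setU1 (hA _ _ iaA ja)// orbT.
  have [->|ib] := eqVneq i b.
    rewrite P'b inE => ja jX; by rewrite in_setU1 (hA _ _ iaA ja)// orbT.
  by rewrite P'// inE => ji jX; exact: hB ji jX.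
have YB : Y \subset B by apply: fintype.subset_trans YA _; exact: finset.subsetUr.
have reg := ae_regular df.
have wdB : {ae @lebesgueV R V, forall v, E v -> well_defined f D B v}.
  by apply: filterS2 reg wd => v rv h /h; exact: (covered_well_defined_add df cr rv iaA).
have eB := doA_ancestral df dE dD aA aB YA YB wd wdB.
have iaB : a \in B by rewrite in_setU1 iaA orbT.
have ibB : b \in B by rewrite in_setU1 eqxx.
exists B; split=> //.
  by apply: filterS2 reg wdB => v rv h /h; exact: (covered_well_defined df cr rv iaB ibB).
have eD : {ae @lebesgueV R V, forall v, E v ->
    (EFin \o fprod f D B) v = (EFin \o fprod f D' B) v}.
  by apply: filterS reg => v rv _ /=; rewrite (covered_fprod df cr rv).
have dE' : depends (~: (B :\: Y))%SET E.
  apply: dependsS dE => j jX; rewrite inE; apply/negP => /finset.setDP[jB _].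
  by have /ancestralP[BX _] := aB'; have := BX _ jB; rewrite jX.
have eD' := ae_int_over (nnm_fprod df D B) (nnm_fprod df D' B) dE' eD.
by apply: filterS3 ephi eB eD' => v h1 h2 h3 Ev; rewrite h1// h2//; exact: h3.
Qed.

End identification.

(** * Directed paths starting with an undirected edge *)

Section criterion.
Variables (V : finType) (G : mixed_graph V) (x y : V).
Hypothesis xy : x != y.

(** The nodes other than [x] with a directed path to [y] that avoids [x]. *)
Definition avoiding_ancestors (D : mixed_graph V) : {set V} :=
  [set w | (w != x) && connect (fun i j => [&& arrow D i j, i != x & j != x]) w y]%SET.

Lemma avoiding_ancestors_ancestral D : ancestral D [set x]%SET (avoiding_ancestors D).
Proof.
apply/ancestralP; split=> [i|i j]; rewrite !inE; first by move=> /andP[].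
move=> /andP[ix iy] ji jx; rewrite jx; apply: connect_trans iy.
by apply: connect1; rewrite ji ix jx.
Qed.

Lemma avoiding_ancestors_y D : y \in avoiding_ancestors D.
Proof. by rewrite inE eq_sym xy connect0. Qed.

(** No DAG of [G] has a directed path from [x] to [y] whose first edge is
    undirected in [G]. *)
Definition no_undirected_start : Prop :=
  forall D b, represented G D -> line G x b -> arrow D x b ->
    b \notin avoiding_ancestors D.

Hypothesis nus : no_undirected_start.

Lemma opposite_line D D' a b : represented G D -> represented G D' ->
  arrow D a b -> arrow D' b a -> line G a b.
Proof.
move=> [_ adj _ arr] [_ adj' _ arr'] ab ba.
have : adjacent G a b by rewrite -adj arrow_adj.
case/adj_case => // [h|h].
  by have := dag_asym (arr' _ _ h); rewrite ba.
by have := dag_asym (arr _ _ h); rewrite ab.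
Qed.

(** Under the criterion all the DAGs of [G] give the same f(y | do(x)). *)
Lemma computes_represented (R : realType) (f : valuation R V -> R) E D1 D2 phi :
  density f -> depends [set x]%SET E ->
  represented G D1 -> represented G D2 ->
  computes f [set x]%SET [set y]%SET E D1 phi ->
  computes f [set x]%SET [set y]%SET E D2 phi.
Proof.
move=> df dE r1 r2; pose C D := computes f [set x]%SET [set y]%SET E D phi.
apply: (@covered_reversal_ind _ G C D1 D2 r1 r2) => D D' a b rD rD' cr.
have [dD _ _ _] := rD; have [dD' _ _ _] := rD'.
have [ab _ P'a _ _] := cr.
have ba : arrow D' b a.
  have : b \in Pa D' a by rewrite P'a in_setU1 eqxx.
  by rewrite inE.
apply: (computes_covered df dE dD dD' cr) => h.
have aa := avoiding_ancestors_ancestral; have ya := avoiding_ancestors_y.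
have lab := opposite_line rD rD' ab ba.
case: h; rewrite inE => /eqP e; rewrite e in ab ba lab cr *.
  exists (avoiding_ancestors D); split; rewrite ?finset.sub1set//.
    by rewrite inE eqxx.
  exact: nus.
have nb : a \notin avoiding_ancestors D' by apply: nus => //; rewrite line_sym.
have nx : x \notin avoiding_ancestors D' by rewrite inE eqxx.
exists (avoiding_ancestors D'); split; rewrite ?finset.sub1set//.
by rewrite (covered_ancestral_out cr).
Qed.

Lemma no_undirected_start_identifiable (R : realType) :
  identifiable R G [set x]%SET [set y]%SET.
Proof.
move=> [D1 [D2 [f [r1 r2 [df _] _ nae]]]]; apply: nae.
pose X := [set x]%SET; pose Y := [set y]%SET.
pose E v := do_defined D1 f X v /\ do_defined D2 f X v.
have dE : depends X E.
  by move=> v w e; rewrite /E !(do_defined_depends _ _ e).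
have [d1 _ _ _] := r1; have [d2 _ _ _] := r2.
have YX : (Y \subset ~: X)%SET by rewrite finset.sub1set !inE eq_sym.
have wd1 := ae_do_defined df D1 X; have wd2 := ae_do_defined df D2 X.
have c1 : computes f X Y E D1 (do_density D1 f X Y).
  exists (~: X)%SET; split=> //; first exact: ancestralC.
    by apply: filterS wd1 => v h [/h].
  by apply: aeW => v _; rewrite do_densityE.
have [A [aA YA wA eA]] := computes_represented df dE r1 r2 c1.
have wd2' : {ae @lebesgueV R V, forall v, E v -> well_defined f D2 (~: X)%SET v}.
  by apply: filterS wd2 => v h [_ /h].
have e := doA_ancestral df dE d2 aA (ancestralC _ _) YA YX wA wd2'.
apply: filterS2 eA e => v h1 h2 e1 e2; rewrite h1// h2// do_densityE//.
Qed.

End criterion.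

(** * Factorisation of the marginals over ancestral sets *)

Section markov.
Variables (R : realType) (V : finType) (f : valuation R V -> R).
Hypothesis df : density f.
Local Open Scope ereal_scope.
Local Notation val := (valuation R V).
Variable D : mixed_graph V.
Hypotheses (dD : dag D) (cD : dag_consistent D f).
Implicit Types (A B P X Y : {set V}) (v w : val).

Lemma fprod_depends X A : ancestral D X A -> depends (A :|: X)%SET (fprod f D A).
Proof.
move=> /ancestralP[_ h] v w e; apply: eq_bigr => i iA.
apply: factor_depends => j; rewrite in_setU1 => /orP[/eqP ->|].
  by apply: e; rewrite inE iA.
rewrite inE => ji; apply: e; rewrite inE.
by case: (boolP (j \in X)) => jX; rewrite ?orbT// (h _ _ iA ji).
Qed.

Lemma ancestral0_max A i (r : V -> nat) :
  (forall x y, arrow D x y -> (r x < r y)%N) ->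
  ancestral D finset.set0 (i |: A)%SET -> i \notin A ->
  (forall j, j \in A -> (r j <= r i)%N) ->
  ancestral D finset.set0 A /\ (forall j, j \in A -> i \notin Pa D j).
Proof.
move=> rP /ancestralP[_ h] iA imax.
have iPa j : j \in A -> i \notin Pa D j.
  by move=> jA; rewrite inE; apply/negP => /rP; rewrite ltnNge imax.
split=> //; apply/ancestralP; split=> [j|j k jA kj k0]; first by rewrite !inE.
have := h j k; rewrite !in_setU1 jA orbT => /(_ isT kj k0) /orP[/eqP e|//].
by have := iPa _ jA; rewrite inE -e kj.
Qed.

(** The product over an ancestral set is a sub-density: undefined factors can
    only decrease its integral. *)
Lemma int_fprod_le1 A v : ancestral D finset.set0 A ->
  int_over A (EFin \o fprod f D A) v <= 1.
Proof.
have [/pdagP[r rP] _] := dD; have [n] := ubnP #|A|.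
elim: n A v => // n IH A v lt aA.
have [->|/set0Pn[i0 i0A]] := eqVneq A finset.set0.
  by rewrite int_over0 /= /fprod big_set0.
case: (arg_maxnP r i0A) => i iA0 imax; have iA : i \in A := iA0.
have eA : A = (i |: (A :\ i))%SET by rewrite finset.setD1K.
have iA' : i \notin (A :\ i)%SET by rewrite !inE eqxx.
have [aA' iPa] : ancestral D finset.set0 (A :\ i)%SET /\
    (forall j, j \in (A :\ i)%SET -> i \notin Pa D j).
  apply: (ancestral0_max rP); rewrite -?eA// => j /finset.setD1P[_ jA].
  exact: imax.
have lt' : (#|(A :\ i)%SET| < n)%N by rewrite (cardsD1 i A) iA in lt; exact: lt.
apply: le_trans (IH _ v lt' aA').
rewrite {1}eA finset.setUC int_overU; last 2 first.
- exact: nnm_fprod.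
- by rewrite disjoint_sym disjoints1.
apply: le_int_seq; [exact/nnm_int_over/nnm_fprod|exact: nnm_fprod|] => w.
rewrite {1}eA int_factor// /= lee_fin ler_piMr ?fprod_ge0//.
by case: (fdef _ _ _ _).
Qed.

(** By induction from the full set down.  Integrating out [i] gives f(a) as the
    product over [A], cut to 0 where the factor of [i] is not well defined.  As
    f(a) has integral 1 and the product has integral at most 1, the cut is void
    almost everywhere. *)
Lemma ae_marginal_ancestral A : ancestral D finset.set0 A ->
  {ae @lebesgueV R V, forall v, marginal f A v = (fprod f D A v)%:E}.
Proof.
have [/pdagP[r rP] _] := dD; have [n] := ubnP #|~: A|%SET.
elim: n A => // n IH A lt aA.
have [eA|/set0Pn[i0 i0A]] := eqVneq (~: A)%SET finset.set0.
  have -> : A = [set: V]%SET by rewrite -(finset.setCK A) eA finset.setC0.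
  apply: filterS cD => v e; rewrite marginalT e; congr EFin.
  by rewrite /fprod; apply: eq_bigl => i; rewrite inE.
case: (arg_minnP r i0A) => i iA0 imin; have iA' : i \in (~: A)%SET := iA0.
have iA : i \notin A by rewrite inE in iA'.
have /ancestralP[_ hA] := aA.
have iPa j : j \in A -> i \notin Pa D j.
  move=> jA; rewrite inE; apply/negP => ij.
  by move: iA; rewrite (hA _ _ jA ij)// inE.
have aiA : ancestral D finset.set0 (i |: A)%SET.
  apply/ancestralP; split=> [j|j k]; first by rewrite !inE.
  rewrite !in_setU1 => /orP[/eqP ->|jA] kj k0; last by rewrite (hA _ _ jA kj)// orbT.
  case: (boolP (k \in A)) => kA; first by rewrite orbT.
  have /imin : k \in (~: A)%SET by rewrite inE.
  by rewrite leqNgt (rP _ _ kj).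
have lt' : (#|~: (i |: A)|%SET < n)%N.
  rewrite (cardsD1 i) iA' add1n ltnS in lt.
  have -> : (~: (i |: A) = (~: A) :\ i)%SET by apply/setP => j; rewrite !inE negb_or.
  exact: lt.
have {}IH := IH _ lt' aiA.
pose q v : R := (fdef f D i v)%:R.
have q0 v : (0 <= q v)%R by [].
have q1 v : (q v <= 1)%R by rewrite /q; case: (fdef _ _ _ _).
have mq : measurable_fun setT q.
  have md : measurable_fun setT (fdef f D i) by exact: measurable_cond_defined.
  have -> : q = (fun b : bool => b%:R%R) \o fdef f D i by [].
  exact: measurableT_comp.
have qE v : int_over [set i]%SET (EFin \o fprod f D (i |: A)%SET) v =
    (fprod f D A v * q v)%:E by rewrite int_factor.
have npq : nnm (fun v => (fprod f D A v * q v)%:E).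
  by apply: (@nnm_fin _ _ (fun v => fprod f D A v * q v)%R);
    [move=> v; rewrite mulr_ge0// fprod_ge0|apply: measurable_funM => //; exact: measurable_fprod].
have npq' : nnm (fun v => (fprod f D A v * (1 - q v))%:E).
  apply: (@nnm_fin _ _ (fun v => fprod f D A v * (1 - q v))%R).
    by move=> v; rewrite mulr_ge0 ?subr_ge0// fprod_ge0.
  by apply: measurable_funM; [exact: measurable_fprod|exact: measurable_funB].
have e1 : {ae @lebesgueV R V, forall v, marginal f A v = (fprod f D A v * q v)%:E}.
  have [ni nf] := (nnm_marginal df (i |: A)%SET, nnm_fprod df D (i |: A)%SET).
  have IH' : {ae @lebesgueV R V, forall v, True ->
      marginal f (i |: A)%SET v = (EFin \o fprod f D (i |: A)%SET) v}.
    by apply: filterS IH.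
  have := ae_int_over ni nf (A := [set i]%SET) (E := fun=> True) (fun _ _ _ => erefl) IH'.
  apply: filterS => v /(_ I); rewrite qE => <-.
  rewrite (marginalS df (B := (i |: A)%SET)); last exact: finset.subsetUr.
  congr int_over; apply/setP => j; rewrite !inE.
  by case: eqVneq => [->|]; rewrite ?iA//= andNb.
have e2 : {ae @lebesgueV R V, forall v,
    int_over A (fun w => (fprod f D A w * (1 - q w))%:E) v = 0}.
  have e1' : {ae @lebesgueV R V, forall v, True ->
      marginal f A v = (fprod f D A v * q v)%:E} by apply: filterS e1.
  have := ae_int_over (nnm_marginal df A) npq (A := A) (E := fun=> True) (fun _ _ _ => erefl) e1'.
  apply: filterS => v /(_ I); rewrite int_over_marginal// => /esym ipq.
  have := int_fprod_le1 v aA.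
  have -> : int_over A (EFin \o fprod f D A) v =
      int_over A (fun w => (fprod f D A w * q w)%:E + (fprod f D A w * (1 - q w))%:E) v.
    by apply: eq_int_over => w _; rewrite -EFinD -mulrDr addrC subrK mulr1.
  rewrite [X in X <= _ -> _](int_seqD _ _ npq npq') -/(int_over _ _) ipq => le.
  apply/eqP; rewrite eq_le (nnm_int_over _ npq').1 andbT.
  by move: le; rewrite -[leRHS]adde0 leeD2lE.
pose N := [set v : val | (fprod f D A v * (1 - q v))%:E != 0]%classic.
have mN : measurable N.
  by rewrite -[X in measurable X]setTI; apply: measurable_neqe => //; exact: npq'.2.
have e3 : {ae @lebesgueV R V, forall v, ~ N v}.
  exists N; split=> //; last by move=> v /contrapT.
  apply: (@null_by_slices _ _ A) => // w.
  have [v ev] := aeV_exists e2.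
  have /(int_seq_eq0 _ _ npq') := ev; rewrite -/(oneN N) => z.
  rewrite -z; have dN : depends A (oneN N).
    have dp := fprod_depends aA; rewrite finset.setU0 in dp.
    have iPa' j : j \in Pa D i -> j \in A.
      rewrite inE => ji; have /ancestralP[_ /(_ i j)] := aiA.
      rewrite !in_setU1 eqxx => /(_ isT ji); rewrite inE => /(_ isT) /orP[/eqP ej|//].
      by move: ji; rewrite ej arrowxx.
    have dq : depends A (fun v => fprod f D A v * (1 - q v))%R.
      move=> u u' e; rewrite (dp _ _ e) /q (@fdef_depends _ _ f D i u u')// => j.
      by move=> /iPa'; exact: e.
    move=> u u' e; rewrite /oneN !indicE; congr (_%:R%:E); congr nat_of_bool.
    by apply/idP/idP => /set_mem Nu; apply/mem_set; move: Nu; rewrite /N /= (dq _ _ e).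
  by apply: (int_over_depends dN) => j; rewrite !inE andNb.
apply: filterS2 e1 e3 => v -> /=; rewrite /N /= => /negP/negPn/eqP[] /eqP.
rewrite mulf_eq0 => /orP[/eqP ->|]; first by rewrite mul0r.
by rewrite subr_eq0 => /eqP <-; rewrite mulr1.
Qed.

End markov.

(** * Adjustment for the parents *)

Section parent_adjustment.
Variables (R : realType) (V : finType) (f : valuation R V -> R).
Hypothesis df : density f.
Local Open Scope ereal_scope.
Local Notation val := (valuation R V).
Variables (D : mixed_graph V) (x : V).
Hypotheses (dD : dag D) (cD : dag_consistent D f).
Implicit Types (A B P X Y : {set V}) (v w : val).

Let P := Pa D x.
Let X := [set x]%SET.

(** The marginals over ancestral sets factorise at [v]. *)
Definition factorizes v : Prop :=
  forall A, ancestral D finset.set0 A -> rm f A v = fprod f D A v.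

Lemma ae_factorizes : {ae @lebesgueV R V, forall v, factorizes v}.
Proof.
apply: filter_forall => A; case: (boolP (ancestral D finset.set0 A)) => aA.
  by apply: filterS (ae_marginal_ancestral df dD cD aA) => v e _; rewrite /rm e.
by apply: aeW => v.
Qed.

(** At a regular [v]: the integrand f(y | x, pa(x)) f(pa(x)) is well defined. *)
Definition overlap v : Prop := rm f P v = 0%R \/ (0 < rm f (x |: P)%SET v)%R.

Lemma rank_ancestral (r : V -> nat) n :
  (forall a b, arrow D a b -> (r a < r b)%N) ->
  ancestral D finset.set0 [set w | (r w < n)%N]%SET.
Proof.
move=> rP; apply/ancestralP; split=> [i|i j]; rewrite !inE//.
by move=> ri /rP rji _; exact: ltn_trans ri.
Qed.

Lemma fprod_gt0 A v : (forall i, i \in A -> factor f D i v != 0%R) ->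
  (0 < fprod f D A v)%R.
Proof.
by move=> h; apply: prodr_gt0 => i iA; rewrite lt0r factor_ge0// h.
Qed.

(** If an undefined factor comes first among the undefined ones, then f vanishes
    on the nodes below its rank, hence so does one of their factors; it is not
    the factor of [x], by overlap. *)
Lemma overlap_well_defined v : regular f v -> factorizes v -> overlap v ->
  well_defined f D (~: X)%SET v.
Proof.
move=> rv fv ov; have [/pdagP[r rP] _] := dD.
apply/well_definedP; apply: contrapT => nwd.
have [i0 /not_implyP[i0X nd0]] := (existsNP _).2 (fun h => nwd (or_introl h)).
have no h := nwd (or_intror h).
have no' j : j != x -> fdef f D j v -> factor f D j v != 0%R.
  move=> jx dj; apply/eqP => cj; apply: no; exists j; split=> //.
  by rewrite !inE.
have b0 : (i0 != x) && ~~ fdef f D i0 v by rewrite !inE in i0X; rewrite i0X; exact/negP.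
case: (@arg_minnP _ i0 (fun i => (i != x) && ~~ fdef f D i v) r b0) => i /andP[ix ndi] imin.
have below j : (r j < r i)%N -> j != x -> factor f D j v != 0%R.
  move=> ji jx; apply: no' => //; apply/negPn/negP => ndj.
  by have := imin j; rewrite jx ndj => /(_ isT); rewrite leqNgt ji.
pose B n := [set w | (r w < n)%N]%SET.
have PaB j : Pa D j \subset B (r j).
  by apply/fintype.subsetP => k; rewrite !inE; exact: rP.
have pB : (0 < fprod f D (B (r i)) v)%R.
  apply: fprod_gt0 => j; rewrite inE => ji; have [ejx|jx] := eqVneq j x; last exact: below.
  have : (0 < rm f (B (r x)) v)%R.
    rewrite fv; last exact: rank_ancestral.
    apply: fprod_gt0 => k; rewrite inE => kx.
    apply: below; first by rewrite (ltn_trans kx)// -ejx.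
    by apply/eqP => ekx; rewrite ekx ltnn in kx.
  move=> /(regular_rm_gt0 df rv (PaB x)) p0.
  have [p0'|xp0] := ov; first by rewrite p0' ltxx in p0.
  by rewrite ejx /factor cond_densityE mulf_neq0// ?invr_eq0 gt_eqF.
move/negP: ndi; apply; rewrite /fdef regular_cond_defined//.
apply: (regular_rm_gt0 df rv (PaB i)).
by rewrite fv//; exact: rank_ancestral.
Qed.

(** The truncated product is f / f(x | pa(x)), and 0 where f(pa(x)) = 0. *)
Lemma overlap_fprod v : regular f v -> factorizes v -> overlap v ->
  fprod f D (~: X)%SET v = (rm f P v / rm f (x |: P)%SET v * f v)%R.
Proof.
move=> rv fv ov; have [/pdagP[r rP] _] := dD.
have fE : f v = (factor f D x v * fprod f D (~: X)%SET v)%R.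
  have := fv [set: V]%SET; rewrite /rm marginalT /= => ->; last first.
    by apply/ancestralP; split=> i *; rewrite inE.
  rewrite /fprod (bigD1 x)//=; congr (_ * _)%R; apply: eq_bigl => i.
  by rewrite !inE.
have [p0|xp0] := ov.
  rewrite p0 !mul0r.
  pose B := [set w | (r w < r x)%N]%SET.
  have : rm f B v = 0%R.
    apply: (regular_rm0 df rv _ p0); apply/fintype.subsetP => k; rewrite !inE.
    exact: rP.
  rewrite fv; last exact: rank_ancestral.
  move=> /eqP; rewrite prodf_seq_eq0 => /hasP[j _ /andP[jB /eqP cj]].
  rewrite /fprod (bigD1 j)/= ?cj ?mul0r//; rewrite !inE in jB *.
  by apply/eqP => e; rewrite e ltnn in jB.
have p0 : (0 < rm f P v)%R.
  by apply: (regular_rm_gt0 df rv _ xp0); exact: finset.subsetUr.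
rewrite fE /factor cond_densityE -/P -/X.
set a := rm f P v in p0 *; set b := rm f _ v in xp0 *; set F := fprod _ _ _ _.
by rewrite !mulrA divfK ?gt_eqF// divff ?gt_eqF// mul1r.
Qed.

Lemma adjustment_defined_depends Z : depends X (adjustment_defined f X Z).
Proof.
move=> v w e; rewrite /adjustment_defined.
suff -> : fix_on X v = fix_on X w by [].
apply/funext => u; apply/funext => i; rewrite /fix_on.
by case: (boolP (i \in X)) => // /e.
Qed.

Lemma ae_overlap :
  {ae @lebesgueV R V, forall v, adjustment_defined f X P v -> overlap v}.
Proof.
pose p v := (marginal f P v == 0) || cond_defined f (X :|: P)%SET v.
have mp : measurable_fun setT p.
  apply: measurable_or; last exact: measurable_cond_defined.
  by apply: measurable_fun_eqe => //; have [] := nnm_marginal df P.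
pose U := [set v : val | ~~ p v]%classic.
have mU : measurable U.
  have := mp measurableT [set false]%classic.
  rewrite setTI => /(_ I); congr measurable.
  by apply/seteqP; split=> v; rewrite /U /=; case: (p v).
apply: filterS2 (ae_regular df) (ae_of_fix_on X mU) => v rv h ad.
have pv : p v.
  apply/negPn/negP => np; apply: h np.
  apply: filterS ad => w ad; apply/negP; rewrite negbK /p.
  by case: ad => [->|->]; rewrite ?eqxx// orbT.
case/orP: pv => [/eqP e|]; first by left; rewrite /rm e.
by rewrite regular_cond_defined//; right.
Qed.

Lemma do_density_adjustment (y : V) : x != y -> y \notin P ->
  {ae @lebesgueV R V, forall v, adjustment_defined f X P v ->
     do_density D f X [set y]%SET v = adjustment f X [set y]%SET P v}.
Proof.
move=> xy yP; pose Y := [set y]%SET; pose E := adjustment_defined f X P.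
have dE : depends X E := @adjustment_defined_depends P.
pose c v : R := (rm f P v / rm f (x |: P)%SET v)%R.
have c0 v : (0 <= c v)%R by rewrite divr_ge0// rm_ge0.
have dc : depends (x |: P)%SET c.
  move=> v w e; rewrite /c /rm (@marginal_depends _ _ f _ _ _ e) (@marginal_depends _ _ f P v w)//.
  by move=> i iP; apply: e; rewrite in_setU1 iP orbT.
have mc : measurable_fun setT c.
  exact: measurable_funM (measurable_rm _ _) (measurable_rmV _ _).
have nf := nnm_density df.
have ncf : nnm (fun v => (c v)%:E * (f v)%:E) by apply: nnmM => //; exact: nnm_fin.
have k1 : {ae @lebesgueV R V, forall v, E v ->
    (EFin \o fprod f D (~: X)%SET) v = (c v)%:E * (f v)%:E}.
  apply: filterS3 (ae_regular df) ae_factorizes ae_overlap => v rv fv ov /ov {}ov.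
  by rewrite /= overlap_fprod// EFinM.
pose S := ((~: X) :\: Y)%SET.
have dE' : depends (~: S)%SET E.
  apply: dependsS dE => j jX; rewrite inE; apply/negP => /finset.setDP[].
  by rewrite inE jX.
have k2 := ae_int_over (nnm_fprod df D (~: X)%SET) ncf dE' k1.
pose m := marginal f (X :|: Y :|: P)%SET.
have nm : nnm m := nnm_marginal df _.
have nc : nnm (fun v => (c v)%:E) by exact: nnm_fin.
have xP : x \notin P := Pa_irr _ _.
have inS := (finset.in_setI, finset.in_set0, finset.in_setD, finset.in_setU, finset.in_setC, finset.in_set1).
have k3 v : int_over S (fun v => (c v)%:E * (f v)%:E) v =
    int_over P (fun v => (c v)%:E * m v) v.
  have -> : S = (P :|: ~: (X :|: Y :|: P))%SET.
    apply/setP => i; rewrite !inS.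
    have [->|iy] := eqVneq i y; first by rewrite (negPf yP) orbT.
    have [->|ix] := eqVneq i x; first by rewrite (negPf xP).
    by rewrite /= orbN.
  rewrite int_overU//; last first.
    rewrite -setI_eq0; apply/eqP/setP => i; rewrite !inS.
    by case: (i \in P); rewrite ?orbT ?andbF.
  apply: eq_int_over => w _; rewrite (@int_overZ _ _ _ (x |: P)%SET)//.
    by move=> u u' e; rewrite (dc _ _ e).
  rewrite -setI_eq0; apply/eqP/setP => i; rewrite !inS.
  by case: (i == x); case: (i \in P); rewrite ?orbT ?andbF.
pose g v : \bar R := (cond_density f Y (X :|: P)%SET v * fine (marginal f P v))%:E.
have ng : nnm g.
  apply: (@nnm_fin _ _ (fun v => cond_density f Y (X :|: P)%SET v * rm f P v)%R).
    by move=> v; rewrite mulr_ge0 ?cond_density_ge0// rm_ge0.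
  by apply: measurable_funM; [exact: measurable_cond_density|exact: measurable_rm].
have k4 : {ae @lebesgueV R V, forall v, True -> (c v)%:E * m v = g v}.
  apply: filterS (ae_regular df) => v rv _.
  rewrite /m regular_marginal// -EFinM; congr EFin.
  rewrite cond_densityE -/(rm f P v) finset.setUA (finset.setUC Y) /c.
  by rewrite mulrAC [in RHS]mulrC mulrA.
have k5 := ae_int_over (A := P) (nnmM nc nm) ng (E := fun=> True) (fun _ _ _ => erefl) k4.
apply: filterS2 k2 k5 => v h2 h5 Ev.
rewrite do_densityE /doA -/S h2// k3 h5// /adjustment.
case: eqVneq => // eP.
rewrite eP int_over0 /g eP marginal0//= mulr1 finset.setU0 //.
Qed.

End parent_adjustment.

Section sufficiency.
Variables (V : finType) (G : mixed_graph V) (x y : V).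
Hypotheses (mG : mpdag G) (xy : x != y) (yP : y \notin Pa G x).
Hypothesis nus : no_undirected_start G x y.

(** A density factorises over one DAG of [G] if and only if it does over all. *)
Lemma dag_consistent_represented (R : realType) (f : valuation R V -> R) D1 D2 :
  density f -> represented G D1 -> represented G D2 ->
  dag_consistent D1 f -> dag_consistent D2 f.
Proof.
move=> df r1 r2; pose C D := dag_consistent D f.
apply: (@covered_reversal_ind _ G C D1 D2 r1 r2) => D D' a b _ _ cr.
apply: filterS2 (ae_regular df) => v rv ->.
have e D0 : (\prod_(i : V) cond_density f [set i]%SET (Pa D0 i) v)%R =
    fprod f D0 [set: V]%SET v.
  by rewrite /fprod; apply: eq_bigl => i; rewrite inE.
by rewrite !e (covered_fprod df cr rv)// inE.
Qed.

Lemma no_undirected_start_adjustment (R : realType) :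
  adjustment_set R G [set x]%SET [set y]%SET (Pa G x).
Proof.
split.
- by rewrite disjoints1 !inE.
- by rewrite disjoints1 Pa_irr.
- by rewrite disjoints1.
move=> f D df _ rD cD.
have [D' rD' ePa] := represented_Pa mG x.
have cD' := dag_consistent_represented df rD rD' cD.
have [dD _ _ _] := rD; have [dD' _ _ _] := rD'.
pose X := [set x]%SET; pose Y := [set y]%SET; pose P := Pa G x.
pose E v := do_defined D f X v /\ adjustment_defined f X P v.
have dE : depends X E.
  move=> v w e; rewrite /E (do_defined_depends _ _ e).
  by rewrite (@adjustment_defined_depends _ _ f x P v w e).
have YX : (Y \subset ~: X)%SET by rewrite finset.sub1set !inE eq_sym.
have c1 : computes f X Y E D (do_density D f X Y).
  exists (~: X)%SET; split=> //; first exact: ancestralC.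
    by apply: filterS (ae_do_defined df D X) => v h [/h].
  by apply: aeW => v _; rewrite do_densityE.
have [A [aA YA wA eA]] := computes_represented xy nus df dE rD rD' c1.
have wd' : {ae @lebesgueV R V, forall v, E v -> well_defined f D' (~: X)%SET v}.
  apply: filterS3 (ae_regular df) (ae_factorizes df dD' cD') (ae_overlap df D' x).
  rewrite ePa => v rv fv ov [_ /ov]; exact: overlap_well_defined.
have e := doA_ancestral df dE dD' aA (ancestralC _ _) YA YX wA wd'.
have := do_density_adjustment df dD' cD' xy; rewrite ePa => /(_ yP) adj.
apply: filterS3 eA e adj => v h1 h2 h3 dd ad.
by rewrite h1// h2// -do_densityE h3.
Qed.

End sufficiency.

(** * A weight and a bounded nowhere vanishing function *)

Section weight.
Variable R : realType.
Local Notation mu := (@lebesgue_measure R).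
Local Open Scope ereal_scope.

Lemma integral_gt0_itv (h : measurableTypeR R -> \bar R) (a b : R) : (a < b)%R ->
  (forall t, 0 <= h t) -> (forall t : R, (a <= t <= b)%R -> 0 < h t) ->
  measurable_fun setT h -> 0 < \int[mu]_t h t.
Proof.
move=> ab h0 hab mh; rewrite lt0e integral_ge0 ?andbT//.
apply/eqP; rewrite integral_eq0P// => -[N [mN N0] sub].
have : mu `[a, b]%classic <= mu N.
  apply: le_measure; rewrite ?inE// => t; rewrite /= in_itv/= => tab.
  by apply: sub => /= e; have := hab _ tab; rewrite e ltxx.
rewrite N0 lebesgue_measure_itv/= lte_fin ab -EFinD lee_fin subr_le0.
by rewrite leNgt ab.
Qed.

(** For [g] the standard normal density, [h] is the indicator of [0, 1] minus
    its mean [p], and [c = p (1 - p)] is its variance. *)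
Lemma weight_exists : exists (g h : R -> R) (c : R),
  [/\ forall t, (0 < g t)%R,
      measurable_fun [set: measurableTypeR R] (g : measurableTypeR R -> measurableTypeR R)
        /\ measurable_fun [set: measurableTypeR R] (h : measurableTypeR R -> measurableTypeR R),
      forall t, (-1 < h t < 1)%R /\ h t != 0%R,
      (0 < c <= 1)%R
    & forall a b : R, (-1 <= a <= 1)%R -> (-1 <= b <= 1)%R ->
        \int[mu]_t (g t * (1 + a * h t) * (1 + b * h t))%:E = (1 + a * b * c)%:E].
Proof.
pose g : measurableTypeR R -> R := normal_pdf 0 1.
have g0 t : (0 < g t)%R.
  rewrite /g normal_pdfE ?oner_eq0//.
  by apply: mulr_gt0; [rewrite normal_peak_gt0 ?oner_eq0|exact: expR_gt0].
have mg : measurable_fun setT g by exact: measurable_normal_pdf.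
have ig : \int[mu]_t (g t)%:E = 1 by exact: integral_normal_pdf.
pose A : set (measurableTypeR R) := `[0%R, 1%R]%classic.
have mA : measurable A by exact: measurable_itv.
pose u t : R := \1_A t.
have mu' : measurable_fun setT u by exact: measurable_indic.
have u01 t : u t = 1%R \/ u t = 0%R by rewrite /u indicE; case: (_ \in _); [left|right].
have u0 t : (0 <= u t)%R by case: (u01 t) => ->.
have u1 t : (0 <= 1 - u t)%R by case: (u01 t) => ->; rewrite ?subrr ?subr0.
pose P := \int[mu]_t (g t * u t)%:E; pose Q := \int[mu]_t (g t * (1 - u t))%:E.
have mP : measurable_fun setT (fun t => (g t * u t)%:E).
  by apply/measurable_EFinP; exact: measurable_funM.
have mQ : measurable_fun setT (fun t => (g t * (1 - u t))%:E).
  by apply/measurable_EFinP; apply: measurable_funM => //; exact: measurable_funB.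
have gu t : 0 <= (g t * u t)%:E by rewrite lee_fin mulr_ge0// ltW.
have gu' t : 0 <= (g t * (1 - u t))%:E by rewrite lee_fin mulr_ge0// ltW.
have PQ : P + Q = 1.
  rewrite -ig -ge0_integralD//; apply: eq_integral => t _.
  by rewrite -EFinD; congr EFin; ring.
have P0 : 0 < P.
  apply: (@integral_gt0_itv _ 0%R 1%R) => // t t01; rewrite lte_fin /u indicE mem_set.
    by rewrite mulr1.
  by rewrite /A /= in_itv.
have Q0 : 0 < Q.
  apply: (@integral_gt0_itv _ 2%R 3%R) => //; first by rewrite ltr_nat.
  move=> t /andP[t2 _]; rewrite lte_fin /u indicE memNset ?subr0 ?mulr1//.
  by rewrite /A /= in_itv/= => /andP[_ t1]; have := le_trans t2 t1; rewrite leNgt ltr1n.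
have [p Pp] : exists p : R, P = p%:E.
  exists (fine P); rewrite fineK// ge0_fin_numE ?ltW//.
  by rewrite (@le_lt_trans _ _ 1) ?ltry// -PQ leeDl// ltW.
have [q Qq] : exists q : R, Q = q%:E.
  exists (fine Q); rewrite fineK// ge0_fin_numE ?ltW//.
  by rewrite (@le_lt_trans _ _ 1) ?ltry// -PQ leeDr// ltW.
rewrite Pp Qq in PQ P0 Q0; rewrite !lte_fin in P0 Q0.
have {}PQ : (p + q = 1)%R by move: PQ; rewrite -EFinD => -[].
exists g, (fun t => u t - p)%R, (p * q)%R; split=> //.
- by split=> //; apply: measurable_funB => //; exact: measurable_cst.
- move=> t; case: (u01 t) => ->; split.
  + by apply/andP; split; lra.
  + by apply/eqP; lra.
  + by apply/andP; split; lra.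
  + by apply/eqP; lra.
- by apply/andP; split; nra.
move=> a b /andP[a1 a2] /andP[b1 b2].
pose k1 := ((1 + a * (1 - p)) * (1 + b * (1 - p)))%R.
pose k2 := ((1 - a * p) * (1 - b * p))%R.
have k10 : (0 <= k1)%R by rewrite mulr_ge0//; nra.
have k20 : (0 <= k2)%R by rewrite mulr_ge0//; nra.
transitivity (\int[mu]_t (k1%:E * (g t * u t)%:E + k2%:E * (g t * (1 - u t))%:E)).
  apply: eq_integral => t _; rewrite -!EFinM -EFinD; congr EFin.
  by rewrite /k1 /k2; case: (u01 t) => ->; ring.
rewrite ge0_integralD//.
- rewrite !ge0_integralZl// -/P -/Q Pp Qq -!EFinM -EFinD; congr EFin.
  by rewrite /k1 /k2 (_ : q = 1 - p)%R; [ring|lra].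
- by move=> t _; rewrite mule_ge0.
- exact: emeasurable_funM.
- by move=> t _; rewrite mule_ge0.
- exact: emeasurable_funM.
Qed.

End weight.

(** * Densities with pairwise dependences along a forest *)

Section tree_model.
Variables (R : realType) (V : finType).
Local Open Scope ereal_scope.
Local Notation mu := (@lebesgue_measure R).
Local Notation val := (valuation R V).
Variables (g h : R -> R) (c : R).
Hypothesis g0 : forall t, (0 < g t)%R.
Hypothesis mg : measurable_fun [set: measurableTypeR R] (g : measurableTypeR R -> R).
Hypothesis mh : measurable_fun [set: measurableTypeR R] (h : measurableTypeR R -> R).
Hypothesis h1 : forall t, (-1 < h t < 1)%R.
Hypothesis c01 : (0 < c <= 1)%R.
Hypothesis gh : forall a b : R, (-1 <= a <= 1)%R -> (-1 <= b <= 1)%R ->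
  \int[mu]_t (g t * (1 + a * h t) * (1 + b * h t))%:E = (1 + a * b * c)%:E.
Variable pd : V -> V.
Implicit Types (A B S : {set V}) (v w : val) (th : V -> bool).

(** The conditional density of the node [i] given its predecessor [pd i]; the
    node is independent of it, with density [g], if [th i] is false. *)
Definition kern th i v : R := (g (v i) * (1 + (th i)%:R * h (v (pd i)) * h (v i)))%R.

(** The product of these conditional densities over [A]. *)
Definition kprod th A v : R := (\prod_(i in A) kern th i v)%R.

Lemma h_le1 t : (-1 <= h t <= 1)%R.
Proof. by have /andP[a b] := h1 t; rewrite !ltW. Qed.

Lemma bool_mul_le1 (b : bool) (s : R) : (-1 <= s <= 1)%R -> (-1 <= b%:R * s <= 1)%R.
Proof. by case: b; rewrite ?mul1r// mul0r lerN10 ler01. Qed.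

Lemma kern_gt0 th i v : (0 < kern th i v)%R.
Proof.
rewrite /kern mulr_gt0// -ltrBlDl sub0r; have := h1 (v i).
have := bool_mul_le1 (th i) (h_le1 (v (pd i))).
rewrite -ler_norml -ltr_norml => b1 a1.
have : (`|(th i)%:R * h (v (pd i)) * h (v i)| < 1)%R.
  by rewrite normrM (le_lt_trans _ a1)// ler_piMl.
by rewrite ltr_norml => /andP[].
Qed.

Lemma kern_depends th i (C : {set V}) : i \in C -> (th i -> pd i \in C) -> depends C (kern th i).
Proof.
move=> iC pC v w e; rewrite /kern (e i)//.
by case: (th i) pC => [/(_ isT) pC|_]; [rewrite (e _ pC)|rewrite !mul0r].
Qed.

Lemma measurable_kern th i : measurable_fun setT (kern th i).
Proof.
have mc j : measurable_fun [set: val] (fun v => h (v j)).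
  exact: (measurableT_comp mh (@measurable_coord R V j)).
apply: measurable_funM; first exact: (measurableT_comp mg (@measurable_coord R V i)).
apply: measurable_funD; first exact: measurable_cst.
by apply: measurable_funM => //; apply: measurable_funM => //; exact: measurable_cst.
Qed.

Lemma kprod_gt0 th A v : (0 < kprod th A v)%R.
Proof. by apply: prodr_gt0 => i _; exact: kern_gt0. Qed.

Lemma measurable_kprod th A : measurable_fun setT (kprod th A).
Proof.
rewrite (_ : kprod th A = fun v => \prod_(i <- enum A) kern th i v)%R; last first.
  by apply/funext => v; rewrite /kprod big_enum.
by apply: measurable_prod => i _; exact: measurable_kern.
Qed.

Lemma nnm_kern th i : nnm (EFin \o kern th i).
Proof.
by apply: nnm_fin => [v|]; [exact/ltW/kern_gt0|exact: measurable_kern].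
Qed.

Lemma nnm_kprod th A : nnm (EFin \o kprod th A).
Proof.
by apply: nnm_fin => [v|]; [exact/ltW/kprod_gt0|exact: measurable_kprod].
Qed.

Lemma int_kern th i v (b : R) : (th i -> pd i != i) -> (-1 <= b <= 1)%R ->
  \int[mu]_t (kern th i (upd v i t) * (1 + b * h t))%:E =
  (1 + (th i)%:R * h (v (pd i)) * b * c)%:E.
Proof.
move=> pi b1; rewrite -gh//; last exact/bool_mul_le1/h_le1.
apply: eq_integral => t _; congr EFin; congr (_ * _)%R.
rewrite /kern /upd eqxx; case: (th i) pi => [/(_ isT)/negPf ->//|_].
by rewrite !mul0r.
Qed.

Lemma int_kern1 th i v : (th i -> pd i != i) ->
  \int[mu]_t (kern th i (upd v i t))%:E = 1.
Proof.
move=> pi; have := int_kern v pi (b := 0%R); rewrite lerN10 ler01 => /(_ isT).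
rewrite mulr0 mul0r addr0 => <-; apply: eq_integral => t _.
by rewrite mul0r addr0 mulr1.
Qed.

Variable r : V -> nat.

(** The predecessors used by [th] come earlier in the rank [r]. *)
Definition ordered th := forall i, th i -> (r (pd i) < r i)%N.

Lemma ordered_neq th i : ordered th -> th i -> pd i != i.
Proof. by move=> o /o; apply: contraTneq => ->; rewrite ltnn. Qed.

(** The nodes of [S] outside [B] can be integrated out when no node of [B] has its
    predecessor among them. *)
Lemma int_kprod th S B v : ordered th -> B \subset S ->
  (forall i, i \in B -> th i -> pd i \notin (S :\: B)%SET) ->
  int_over (S :\: B)%SET (EFin \o kprod th S) v = (kprod th B v)%:E.
Proof.
move=> o; have [n] := ubnP #|S :\: B|%SET; elim: n B v => // n IH B v lt BS clB.
have [e|/set0Pn[i0 i0S]] := eqVneq (S :\: B)%SET finset.set0.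
  rewrite e int_over0; congr (kprod th _ v)%:E.
  by apply/eqP; rewrite finset.eqEsubset BS -finset.setD_eq0 e eqxx.
case: (arg_minnP r i0S) => i iSB0 imin; have iSB : i \in (S :\: B)%SET := iSB0.
have /finset.setDP[iS iB] := iSB.
have eSB : (S :\: B = [set i] :|: (S :\: (i |: B)))%SET.
  apply/setP => j; rewrite !(finset.in_setU, finset.in_setD, finset.in_set1).
  by case: eqVneq => [->|]//=; rewrite iB.
rewrite [in LHS]eSB int_overU; [|exact: nnm_kprod|]; last first.
  by rewrite disjoints1 !(finset.in_setU, finset.in_setD, finset.in_set1) eqxx.
have pinB j : th j -> pd j = i -> j \notin B.
  by move=> tj e; apply/negP => jB; have := clB _ jB tj; rewrite e iSB.
have IH' w : int_over (S :\: (i |: B))%SET (EFin \o kprod th S) w =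
    (kprod th (i |: B)%SET w)%:E.
  apply: IH.
  - rewrite ltnS in lt; apply: leq_trans lt; apply: proper_card; rewrite eSB.
    apply/properP; split; first exact: finset.subsetUr.
    by exists i; rewrite !(finset.in_setU, finset.in_setD, finset.in_set1) eqxx.
  - by apply/fintype.subsetP => j; rewrite in_setU1 => /orP[/eqP ->//|]; exact: fintype.subsetP.
  - move=> j; rewrite in_setU1 => /orP[/eqP ->|jB] tj.
      apply/negP => /finset.setDP[pS]; rewrite in_setU1 negb_or => /andP[_ pB].
      have /imin : pd i \in (S :\: B)%SET by rewrite finset.in_setD pB.
      by rewrite leqNgt o.
    apply: contra (clB _ jB tj) => /finset.setDP[pS]; rewrite in_setU1 negb_or.
    by move=> /andP[_ pB]; rewrite finset.in_setD pB.
rewrite (_ : int_over _ (EFin \o _) = fun w => (kprod th (i |: B)%SET w)%:E); last first.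
  by apply/funext.
rewrite int_over1.
under eq_integral => t _.
  rewrite /kprod big_setU1//= EFinM.
  rewrite (eq_bigr (fun j => kern th j v)); last first.
    move=> j jB; apply: (@depends_upd R V _ [set k | k != i]%SET); last first.
      by rewrite inE eqxx.
    apply: kern_depends; rewrite inE; first by apply: contraNneq iB => <-.
    by move=> tj; apply/eqP => /(pinB _ tj); rewrite jB.
  rewrite -/(kprod th B v) muleC; over.
rewrite ge0_integralZl//.
- by rewrite int_kern1 ?mule1// => /ordered_neq; exact.
- exact: (nnm_upd v i (nnm_kern th i)).
- by move=> t _; rewrite lee_fin ltW// kern_gt0.
- by rewrite lee_fin ltW// kprod_gt0.
Qed.

Section markov.
Variable th : V -> bool.
Hypothesis oth : ordered th.
Let f : val -> R := kprod th [set: V]%SET.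

Lemma tree_density : density f.
Proof.
split; first exact: measurable_kprod.
  by move=> v; exact/ltW/kprod_gt0.
rewrite (integral_lebesgueV (nnm_kprod th [set: V]%SET)).
have := @int_kprod th [set: V]%SET finset.set0 (fun=> 0%R) oth (finset.sub0set _).
rewrite finset.setD0 => -> //; first by rewrite /kprod big_set0.
by move=> i; rewrite inE.
Qed.

Lemma tree_marginal_closed B v : (forall i, i \in B -> th i -> pd i \in B) ->
  marginal f B v = (kprod th B v)%:E.
Proof.
move=> cB; rewrite /marginal -finset.setTD int_kprod ?finset.subsetT//.
by move=> i iB ti; rewrite finset.in_setD negb_and negbK cB.
Qed.

Lemma tree_marginal_gt0 A v : 0 < marginal f A v.
Proof.
apply: int_seq_gt0; first exact: nnm_kprod.
by move=> w; rewrite lte_fin; exact: kprod_gt0.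
Qed.

Lemma ae_tree_defined :
  {ae @lebesgueV R V, forall v, forall A, cond_defined f A v}.
Proof.
apply: filterS (ae_regular tree_density) => v rv A.
by have [fin _] := rv; rewrite /cond_defined tree_marginal_gt0 fin.
Qed.

Lemma ae_tree_cond_density D : (forall i, th i -> arrow D (pd i) i) ->
  (forall a b, arrow D a b -> (r a < r b)%N) ->
  {ae @lebesgueV R V, forall v, forall i,
     cond_density f [set i]%SET (Pa D i) v = kern th i v}.
Proof.
move=> thD rP; apply: filterS ae_tree_defined => v cd i.
pose B := [set w | (r w < r i)%N]%SET.
have iB : i \notin B by rewrite inE ltnn.
have PB : Pa D i \subset B by apply/fintype.subsetP => j; rewrite !inE; exact: rP.
have clB j : j \in B -> th j -> pd j \in B.
  by rewrite !inE => ji tj; apply: ltn_trans ji; exact/rP/thD.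
have cliB j : j \in (i |: B)%SET -> th j -> pd j \in (i |: B)%SET.
  rewrite !in_setU1 => /orP[/eqP ->|jB] tj; last by rewrite clB// orbT.
  by rewrite inE oth// orbT.
have nk := nnm_kern th i.
have df := tree_density.
have e : marginal f (i |: Pa D i)%SET v = (kern th i v)%:E * marginal f (Pa D i) v.
  rewrite (marginalS df v PB) (@marginalS _ _ _ df (i |: Pa D i)%SET (i |: B)%SET); last first.
    exact: finset.setUS.
  have -> : ((i |: B) :\: (i |: Pa D i) = B :\: Pa D i)%SET.
    apply/setP => j; rewrite !(finset.in_setU, finset.in_setD, finset.in_set1).
    case: eqVneq => [->|]//=; by rewrite (negPf iB) andbF.
  rewrite -(@int_overZ _ _ _ (i |: Pa D i)%SET (EFin \o kern th i)).
  - apply: eq_int_over => w _; rewrite !tree_marginal_closed//.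
    by rewrite /kprod big_setU1//= EFinM.
  - exact: nnm_marginal.
  - by move=> w; exact: nk.1.
  - move=> w w' ew; congr EFin; apply: (kern_depends _ _ ew).
      by rewrite in_setU1 eqxx.
    by move=> /thD ti; rewrite in_setU1 inE ti orbT.
  - rewrite -setI_eq0; apply/eqP/setP => j.
    rewrite !(finset.in_setI, finset.in_setU, finset.in_setD, finset.in_set1, finset.in_set0).
    case: eqVneq => [->|_]/=; first by rewrite (negPf iB) andbF.
    by case: (j \in Pa D i); rewrite ?andbF.
have /andP[m0 mfin] := cd (Pa D i).
have mf : marginal f (Pa D i) v \is a fin_num by rewrite ge0_fin_numE ?ltW.
rewrite /cond_density e -[X in (_ * X)](fineK mf) -EFinM /=.
by rewrite mulfK// gt_eqF// fine_gt0// m0.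
Qed.

Lemma tree_dag_consistent D : (forall i, th i -> arrow D (pd i) i) ->
  (forall a b, arrow D a b -> (r a < r b)%N) -> dag_consistent D f.
Proof.
move=> thD rP; apply: filterS (ae_tree_cond_density thD rP) => v e.
rewrite /f /kprod; apply: eq_big => [i|i _]; first by rewrite inE.
by rewrite e.
Qed.

End markov.

(** Integrating the last node of a chain against [1 + h] multiplies [h] by
    [th i * c] and moves it to the predecessor; the start [s] of the chain is not
    integrated. *)
Lemma int_chain th (s : V) (q : seq V) v :
  path (fun a b => a == pd b) s q -> uniq (s :: q) ->
  int_seq q (fun w => (1 + h (w (last s q)))%:E * (\prod_(i <- q) kern th i w)%:E) v =
  (1 + (\prod_(i <- q) ((th i)%:R * c)) * h (v s))%:E.
Proof.
have pr01 (q' : seq V) : (0 <= \prod_(i <- q') ((th i)%:R * c) <= 1)%R.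
  have /andP[c0 c1] := c01.
  elim: q' => [|i q' /andP[a b]]; first by rewrite big_nil lexx ler01.
  have [t0 t1] : (0 <= (th i)%:R * c)%R /\ ((th i)%:R * c <= 1)%R.
    by case: (th i); rewrite ?mul1r ?mul0r ?ler01; split=> //; exact: ltW.
  by rewrite big_cons; apply/andP; split; [exact: mulr_ge0|exact: mulr_ile1].
elim: q s v => [|i q IH] s v /=.
  by move=> _ _; rewrite !big_nil mul1r mule1.
move=> /andP[/eqP esi pq] /andP[]; rewrite inE negb_or => /andP[si sq] /andP[iq uq].
pose Q := (\prod_(i <- q) ((th i)%:R * c))%R.
have [Q0 Q1] : (0 <= Q)%R /\ (Q <= 1)%R by apply/andP; exact: pr01.
have nF : nnm (fun w => (1 + h (w (last i q)))%:E * (\prod_(j <- q) kern th j w)%:E).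
  apply: nnmM.
    apply: (@nnm_fin _ _ (fun w => 1 + h (w (last i q)))%R).
      by move=> w; have /andP[a _] := h_le1 (w (last i q)); lra.
    apply: measurable_funD; first exact: measurable_cst.
    exact: (measurableT_comp mh (@measurable_coord R V _)).
  apply: (@nnm_fin _ _ (fun w => \prod_(j <- q) kern th j w)%R).
    by move=> w; apply: prodr_ge0 => j _; exact/ltW/kern_gt0.
  by apply: measurable_prod => j _; exact: measurable_kern.
transitivity (\int[mu]_t (kern th i (upd v i t) * (1 + Q * h t))%:E); last first.
  rewrite int_kern; last 2 first.
  - by rewrite -esi => _.
  - by rewrite Q1 andbT (le_trans _ Q0)// lerN10.
  rewrite big_cons -/Q -esi; congr EFin; ring.
apply: eq_integral => t _.
under eq_int_seq => w _.
  rewrite big_cons EFinM muleCA; over.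
rewrite (@int_seqZ _ _ _ (EFin \o kern th i))//.
- rewrite IH//=; last by rewrite iq.
  by rewrite -EFinM; congr (_ * (1 + _ * h _))%:E; rewrite /upd eqxx.
- by move=> w; rewrite lee_fin ltW// kern_gt0.
- move=> j w u jq; congr EFin; apply: (@depends_upd R V _ [set k | k != j]%SET); last first.
    by rewrite inE eqxx.
  apply: kern_depends; rewrite inE; first by apply: contraTneq jq => <-.
  by move=> _; rewrite -esi; apply: contraTneq jq => <-.
Qed.

End tree_model.

(** * Two DAGs with different causal effects *)

Section necessity.
Variables (V : finType) (G : mixed_graph V) (x y : V).
Hypotheses (mG : mpdag G) (xy : x != y).

Lemma avoiding_ancestorsP D b : b \in avoiding_ancestors x y D -> arrow D x b ->
  exists q, [/\ path (arrow D) x (b :: q), uniq [:: x, b & q] & last b q = y].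
Proof.
rewrite inE => /andP[bx /connectP[q0 pq0 ey]] xb.
rewrite ey; case/shortenP: pq0 => q pq uq _; exists q.
have xq : x \notin q.
  elim: q b {uq ey bx xb} pq => //= i q IH b /andP[/and3P[_ _ ix] pq].
  by rewrite inE negb_or eq_sym ix (IH i).
split=> //.
  rewrite /= xb /=; apply: sub_path pq => i j; by case/and3P.
by rewrite cons_uniq uq inE negb_or eq_sym bx xq.
Qed.

Section chain.
Variables (D1 : mixed_graph V) (b : V) (q : seq V) (r : V -> nat).
Let p := b :: q.
Hypotheses (pp : path (arrow D1) x p) (up : uniq (x :: p)) (lp : last x p = y).
Hypothesis rP : forall a b, arrow D1 a b -> (r a < r b)%N.

(** The predecessor of the node [i] on the path; [x :: p] lags [p] by one
    position. *)
Definition pred_on i : V := nth x (x :: p) (index i p).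

Let xp : x \notin p. Proof. by have /andP[] := up. Qed.
Let up' : uniq p. Proof. by have /andP[] := up. Qed.

Lemma pred_arrow i : i \in p -> arrow D1 (pred_on i) i.
Proof.
move=> ip; have lt : (index i p < size p)%N by rewrite index_mem.
by have := pathP x pp _ lt; rewrite nth_index.
Qed.

Lemma pred_path : path (fun a b => a == pred_on b) x p.
Proof.
apply/(pathP x) => k kp; apply/eqP; rewrite /pred_on.
by rewrite index_uniq.
Qed.

Lemma pred_head : pred_on b = x.
Proof. by rewrite /pred_on /p /= eqxx. Qed.

Lemma pred_mem i : i \in p -> pred_on i \in x :: p.
Proof.
move=> ip; have lt : (index i p < size p)%N by rewrite index_mem.
by apply: mem_nth; exact: ltnW lt.
Qed.

Lemma pred_neq i : i \in p -> i != b -> pred_on i != x.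
Proof.
move=> ip ib; rewrite /pred_on /p /= (eq_sym b i) (negPf ib) /=.
have iq : i \in q by move: ip; rewrite inE (negPf ib).
have lt : (index i q < size p)%N by rewrite /p /= ltnS index_size.
by apply: contraNneq xp => <-; exact: mem_nth.
Qed.

Variable R : realType.
Local Open Scope ereal_scope.
Local Notation mu := (@lebesgue_measure R).
Local Notation val := (valuation R V).
Variables (g h : R -> R) (c : R).
Hypothesis g0 : forall t, (0 < g t)%R.
Hypothesis mg : measurable_fun [set: measurableTypeR R] (g : measurableTypeR R -> R).
Hypothesis mh : measurable_fun [set: measurableTypeR R] (h : measurableTypeR R -> R).
Hypothesis h1 : forall t, (-1 < h t < 1)%R.
Hypothesis hn0 : forall t, h t != 0%R.
Hypothesis c01 : (0 < c <= 1)%R.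
Hypothesis gh : forall a b : R, (-1 <= a <= 1)%R -> (-1 <= b <= 1)%R ->
  \int[mu]_t (g t * (1 + a * h t) * (1 + b * h t))%:E = (1 + a * b * c)%:E.
Implicit Types (v w : val).

Let X := [set x]%SET.
Let Y := [set y]%SET.
Let S := ((~: X) :\: Y)%SET.
Local Notation chain_prod := (kprod g h pred_on).

Let nnm_test : nnm (fun v : val => (1 + h (v y))%:E).
Proof.
apply: (@nnm_fin _ _ (fun v => 1 + h (v y))%R).
  by move=> w; have /andP[a _] := h1 (w y); lra.
apply: measurable_funD; first exact: measurable_cst.
exact: (measurableT_comp mh (@measurable_coord R V y)).
Qed.

(** The test function [1 + h (v y)] distinguishes the two interventional
    densities. *)
Lemma int_test (th : V -> bool) v : (forall i, th i -> i \in p) ->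
  int_over Y (fun w => (1 + h (w y))%:E * int_over S (EFin \o chain_prod th (~: X)%SET) w) v =
  (1 + (\prod_(i <- p) ((th i)%:R * c)) * h (v x))%:E.
Proof.
move=> thp; have oth : ordered pred_on r th by move=> i /thp/pred_arrow/rP.
have nk := nnm_kprod g0 mg mh h1 pred_on th (~: X)%SET.
have yp : y \in p by rewrite -lp /p /= mem_last.
pose u v : \bar R := (1 + h (v y))%:E.
have nu : nnm u := nnm_test.
have u0 w : 0 <= u w := nu.1 w.
have du : depends Y u by move=> w w' e; rewrite /u e// inE.
have nuk : nnm (fun w => u w * (EFin \o chain_prod th (~: X)%SET) w) by exact: nnmM.
have dS : [disjoint S & Y].
  by rewrite disjoint_sym disjoints1 finset.in_setD finset.in_set1 eqxx.
transitivity (int_over Y (int_over S (fun w => u w * (EFin \o chain_prod th (~: X)%SET) w)) v).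
  by apply: eq_int_over => w _; rewrite (@int_overZ _ _ _ Y).
rewrite -int_overU//; last by rewrite disjoint_sym.
pose B := [set i in p]%SET.
have inB j : (j \in B) = (j \in p) by rewrite inE.
pose O := (~: X :\: B)%SET.
have BX : B \subset (~: X)%SET.
  apply/fintype.subsetP => i; rewrite !inE; apply: contraTneq => ->.
  by have := xp; rewrite inE.
transitivity (int_seq (p ++ enum O) (fun w => u w * (EFin \o chain_prod th (~: X)%SET) w) v).
  apply: int_seq_perm => //; apply: uniq_perm; first exact: enum_uniq.
    rewrite cat_uniq up' enum_uniq andbT /=; apply/hasPn => i.
    by rewrite mem_enum => /finset.setDP[_]; rewrite inE.
  move=> i; rewrite mem_cat !mem_enum.
  rewrite !(finset.in_setU, finset.in_setD, finset.in_setC, finset.in_set1, finset.in_set).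
  have [->|ix] := eqVneq i x; first by rewrite andbF (negPf xy) (negPf xp) andbF.
  rewrite !andbT orbN; by case: (i \in p).
rewrite int_seq_cat -(int_chain g0 mg mh h1 c01 gh th v pred_path up) lp.
apply: eq_int_seq => w _; rewrite -/(int_over O _) (@int_overZ _ _ _ Y)//; last first.
  by rewrite disjoint_sym disjoints1 finset.in_setD inB yp.
rewrite (int_kprod g0 mg mh h1 gh _ oth BX); last first.
  move=> i; rewrite inB => ip _; have := pred_mem ip; rewrite in_cons.
  rewrite finset.in_setD inB negb_and negbK finset.in_setC finset.in_set1 negbK.
  by move=> /orP[->|->]; rewrite ?orbT.
congr (_ * _%:E); rewrite /kprod big_uniq//.
by apply: eq_bigl => i; rewrite inE.
Qed.

(** [th1] makes every node of the path depend on its predecessor; [th0] cuts the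
    dependence of [b] on [x]. *)
Let th1 i := i \in p.
Let th0 i := (i \in p) && (i != b).
Let f : val -> R := chain_prod th1 [set: V]%SET.

Let df : density f.
Proof.
apply: (tree_density g0 mg mh h1 gh (r := r)) => i /pred_arrow.
exact: rP.
Qed.

Let bx : b != x.
Proof. by apply: contraNneq xp => <-; rewrite mem_head. Qed.

(** The conditional density of [x] given [b]. *)
Let phi v : R := (g (v x) * (1 + h (v b) * h (v x)))%R.

Let phi_gt0 v : (0 < phi v)%R.
Proof.
rewrite /phi mulr_gt0//; have /andP[a1 a2] := h1 (v x); have /andP[b1 b2] := h1 (v b).
set s := h (v b) in b1 b2 *; set t := h (v x) in a1 a2 *; nra.
Qed.

Let f_split v : f v = (phi v * chain_prod th0 (~: X)%SET v)%R.
Proof.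
rewrite /f /kprod (bigD1 x)/= ?inE// (bigD1 b)/=; last by rewrite !inE.
rewrite [in RHS](bigD1 b)/=; last by rewrite !inE.
rewrite !mulrA; congr (_ * _)%R.
  rewrite /kern /th1 /th0 (negPf xp) mem_head eqxx /= !mul0r addr0 mulr1 mul1r.
  rewrite pred_head /phi; ring.
apply: eq_big => [i|i /andP[_ ib]]; first by rewrite !inE.
by rewrite /kern /th1 /th0 ib andbT.
Qed.

Let rho_depends : depends (~: X)%SET (chain_prod th0 (~: X)%SET).
Proof.
move=> v w e; apply: eq_bigr => i; rewrite finset.in_setC finset.in_set1 => ix.
apply: (kern_depends _ _ _ _ e); rewrite finset.in_setC finset.in_set1//.
by move=> /andP[ip ib]; exact: pred_neq.
Qed.

Variable D2 : mixed_graph V.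
Hypothesis cD2 : dag_consistent D2 f.
Hypothesis bD2 : b \in Pa D2 x.

(** In [D2], where [b] is a parent of [x], the factor of [x] involves [b] only:
    [x] occurs in no other term of [f]. *)
Lemma reversed_factor : {ae @lebesgueV R V, forall v, factor f D2 x v = phi v}.
Proof.
set Q := Pa D2 x; have bQ : b \in Q := bD2.
have xQ : x \notin Q := Pa_irr _ _.
apply: filterS (ae_tree_defined g0 mg mh h1 gh (th := th1) (r := r) _) => [|i /pred_arrow]; last exact: rP.
move=> v cd.
pose M : val -> \bar R := int_over (~: (x |: Q))%SET (EFin \o chain_prod th0 (~: X)%SET).
have nr := nnm_kprod g0 mg mh h1 pred_on th0 (~: X)%SET.
have nphi : nnm (EFin \o phi).
  apply: nnm_fin => [w|]; first exact: ltW.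
  have mc k j : measurable_fun [set: measurableTypeR R] (k : measurableTypeR R -> R) ->
      measurable_fun [set: val] (fun v => k (v j)).
    by move=> mk; exact: (measurableT_comp mk (@measurable_coord R V j)).
  apply: measurable_funM; first exact: mc.
  apply: measurable_funD; first exact: measurable_cst.
  by apply: measurable_funM; exact: mc.
have mM w : marginal f (x |: Q)%SET w = (phi w)%:E * M w.
  rewrite /marginal -(@int_overZ _ _ _ (x |: Q)%SET (EFin \o phi))//.
  - by apply: eq_int_over => u _; rewrite /= f_split EFinM.
  - by move=> u; rewrite lee_fin ltW.
  - move=> u u' e; congr EFin; rewrite /phi (e x) ?in_setU1 ?eqxx// (e b)//.
    by rewrite in_setU1 bQ orbT.
  - by rewrite disjoint_sym disjC.
have MQ : marginal f Q v = M v.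
  rewrite (marginalS df v (finset.subsetUr X Q)).
  have -> : ((x |: Q) :\: Q = [set x])%SET.
    apply/setP => j; rewrite !(finset.in_setU, finset.in_setD, finset.in_set1).
    by case: eqVneq => [->|]; rewrite ?xQ//= andNb.
  rewrite int_over1.
  have dM : depends ((~: X) :\: ~: (x |: Q))%SET M.
    by apply: int_over_depends => u u' e; congr EFin; exact: rho_depends.
  under eq_integral => t _.
    rewrite mM (depends_upd v t dM); last by rewrite !inE eqxx andbF.
    rewrite muleC; over.
  rewrite ge0_integralZl//.
  - rewrite (_ : \int[mu]_t (phi (upd v x t))%:E = 1) ?mule1//.
    have -> : 1 = (1 + h (v b) * 0 * c)%:E by rewrite mulr0 mul0r addr0.
    rewrite -gh ?lerN10 ?ler01//; last exact/h_le1.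
    apply: eq_integral => t _; congr EFin.
    by rewrite /phi /upd eqxx (negPf bx) mul0r addr0 mulr1.
  - exact: (nnm_upd v x nphi).
  - by move=> t _; exact: nphi.1.
  - exact: (nnm_int_over _ nr).1.
have /andP[m0 mfin] := cd Q.
have mf : marginal f Q v \is a fin_num by rewrite ge0_fin_numE ?ltW.
rewrite /factor /cond_density -/Q mM -MQ -(fineK mf) -EFinM /=.
by rewrite mulfK// gt_eqF// fine_gt0// m0.
Qed.

Lemma do_density_forward : {ae @lebesgueV R V, forall v,
  do_density D1 f X Y v = int_over S (EFin \o chain_prod th1 (~: X)%SET) v}.
Proof.
have nk := nnm_kprod g0 mg mh h1 pred_on th1 (~: X)%SET.
have o1 : ordered pred_on r th1 by move=> i /pred_arrow/rP.
have e : {ae @lebesgueV R V, forall v, True ->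
    (EFin \o fprod f D1 (~: X)%SET) v = (EFin \o chain_prod th1 (~: X)%SET) v}.
  have := ae_tree_cond_density g0 mg mh h1 gh o1 (fun i => @pred_arrow i) rP.
  apply: filterS => v e _; congr EFin; apply: eq_bigr => i _; exact: e.
have := ae_int_over (A := S) (nnm_fprod df D1 _) nk (E := fun=> True) (fun _ _ _ => erefl) e.
by apply: filterS => v /(_ I) <-; rewrite do_densityE.
Qed.

Lemma do_density_backward : {ae @lebesgueV R V, forall v,
  do_density D2 f X Y v = int_over S (EFin \o chain_prod th0 (~: X)%SET) v}.
Proof.
have nk := nnm_kprod g0 mg mh h1 pred_on th0 (~: X)%SET.
have e : {ae @lebesgueV R V, forall v, True ->
    (EFin \o fprod f D2 (~: X)%SET) v = (EFin \o chain_prod th0 (~: X)%SET) v}.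
  apply: filterS2 cD2 reversed_factor => v ef ephi _; congr EFin.
  apply: (mulfI (x := phi v)); first by rewrite gt_eqF.
  rewrite -f_split ef -ephi (bigD1 x)//=; congr (_ * _)%R.
  by apply: eq_bigl => i; rewrite !inE.
have := ae_int_over (A := S) (nnm_fprod df D2 _) nk (E := fun=> True) (fun _ _ _ => erefl) e.
by apply: filterS => v /(_ I) <-; rewrite do_densityE.
Qed.

Lemma do_density_differ : ~ {ae @lebesgueV R V, forall v,
  do_density D1 f X Y v = do_density D2 f X Y v}.
Proof.
move=> e.
have n1 := nnm_kprod g0 mg mh h1 pred_on th1 (~: X)%SET.
have n0 := nnm_kprod g0 mg mh h1 pred_on th0 (~: X)%SET.
have nu := nnm_test.
have e' : {ae @lebesgueV R V, forall v, True ->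
    (1 + h (v y))%:E * int_over S (EFin \o chain_prod th1 (~: X)%SET) v =
    (1 + h (v y))%:E * int_over S (EFin \o chain_prod th0 (~: X)%SET) v}.
  apply: filterS3 e do_density_forward do_density_backward => v ev e1 e0 _.
  by rewrite -e1 -e0 ev.
have := ae_int_over (A := Y) (nnmM nu (nnm_int_over S n1)) (nnmM nu (nnm_int_over S n0))
  (E := fun=> True) (fun _ _ _ => erefl) e'.
move=> /aeV_exists[v /(_ I)]; rewrite !int_test//; last by move=> i /andP[].
have -> : (\prod_(i <- p) ((th0 i)%:R * c))%R = 0%R.
  by rewrite /p big_cons /th0 eqxx andbF !mul0r.
move=> -[] /eqP; rewrite mul0r addr0 -subr_eq0 addrC addKr mulf_eq0 (negPf (hn0 _)) orbF.
apply/negP; rewrite gt_eqF// big_seq; apply: prodr_gt0 => i ip.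
by rewrite /th1 ip mul1r; have /andP[] := c01.
Qed.

End chain.
Lemma undirected_start_counterexample (R : realType) :
  ~ no_undirected_start G x y ->
  exists (D1 D2 : mixed_graph V) (f : valuation R V -> R),
    [/\ represented G D1, represented G D2, density f,
        dag_consistent D1 f /\ dag_consistent D2 f
      & {ae @lebesgueV R V, forall v, forall A, cond_defined f A v} /\
        ~ {ae @lebesgueV R V, forall v, do_density D1 f [set x]%SET [set y]%SET v =
             do_density D2 f [set x]%SET [set y]%SET v}].
Proof.
move=> /existsNP[D1 /existsNP[b /not_implyP[r1 /not_implyP[lxb /not_implyP[xb]]]]].
move=> /negP/negPn/avoiding_ancestorsP/(_ xb)[q [pp up lp]].
have [[/pdagP[r rP] _] _ _ _] := r1.
have [g [h [c [g0 [mg mh] h1 c01 gh]]]] := weight_exists R.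
have h1' t : (-1 < h t < 1)%R by case: (h1 t).
have hn0 t : h t != 0%R by case: (h1 t).
pose f := kprod g h (pred_on b q) (mem (b :: q)) [set: V]%SET.
have arr i : i \in b :: q -> arrow D1 (pred_on b q i) i by exact: pred_arrow pp _.
have ord : ordered (pred_on b q) r (mem (b :: q)) by move=> i /arr/rP.
have df : density f := tree_density g0 mg mh h1' gh ord.
have c1 : dag_consistent D1 f := tree_dag_consistent g0 mg mh h1' gh ord arr rP.
have [D2 r2 P2] := represented_Pa mG b.
have c2 := dag_consistent_represented df r1 r2 c1.
have bx : b \in Pa D2 x.
  have [_ adj _ _] := r2; have [d2 _ _ _] := r2.
  have : adjacent D2 x b by rewrite adj line_adj.
  rewrite dag_adj// inE => /orP[xb2|//].
  have : x \in Pa D2 b by rewrite inE.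
  by rewrite P2 inE line_arrow.
exists D1, D2, f; split=> //; split; first exact: (ae_tree_defined g0 mg mh h1' gh ord).
exact: (do_density_differ pp up lp rP g0 mg mh h1' hn0 c01 gh c2 bx).
Qed.

Lemma undirected_start_not_identifiable (R : realType) :
  ~ no_undirected_start G x y -> ~ identifiable R G [set x]%SET [set y]%SET.
Proof.
move=> /(undirected_start_counterexample R)[D1 [D2 [f [r1 r2 df [c1 c2] [cd ne]]]]].
apply; exists D1, D2, f; split=> //; first by split=> //; exists D1.
move=> e; apply: ne.
have dd D : {ae @lebesgueV R V, forall v, do_defined D f [set x]%SET v}.
  apply: filterS (ae_fix_on [set x]%SET cd) => v; apply: filterS => w cdw.
  by left=> i _; exact: cdw.
by apply: filterS3 e (dd D1) (dd D2) => v ev d1 d2; exact: ev.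
Qed.

Lemma undirected_start_no_adjustment (R : realType) (Z : {set V}) :
  ~ no_undirected_start G x y -> ~ adjustment_set R G [set x]%SET [set y]%SET Z.
Proof.
move=> /(undirected_start_counterexample R)[D1 [D2 [f [r1 r2 df [c1 c2] [cd ne]]]]].
move=> [_ _ _ adj]; apply: ne.
have cG : consistent G f by exists D1.
have dd : {ae @lebesgueV R V, forall v,
    do_defined D1 f [set x]%SET v /\ do_defined D2 f [set x]%SET v}.
  apply: filterS (ae_fix_on [set x]%SET cd) => v e.
  by split; apply: filterS e => w cdw; left=> i _; exact: cdw.
have ad : {ae @lebesgueV R V, forall v, adjustment_defined f [set x]%SET Z v}.
  apply: filterS (ae_fix_on [set x]%SET cd) => v; apply: filterS => w cdw.
  by right; exact: cdw.
have a1 := adj f D1 df cG r1 c1; have a2 := adj f D2 df cG r2 c2.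
have {}a2 : {ae @lebesgueV R V, forall v,
    do_density D2 f [set x]%SET [set y]%SET v = adjustment f [set x]%SET [set y]%SET Z v}.
  by apply: filterS3 a2 dd ad => v e [_ d] a; exact: e.
have {}a1 : {ae @lebesgueV R V, forall v,
    do_density D1 f [set x]%SET [set y]%SET v = adjustment f [set x]%SET [set y]%SET Z v}.
  by apply: filterS3 a1 dd ad => v e [d _] a; exact: e.
by apply: filterS2 a1 a2 => v -> ->.
Qed.

End necessity.

Theorem proposition4p2 (R : realType) (V : finType) (G : mixed_graph V)
    (X Y : V) :
  mpdag G -> X != Y -> Y \notin Pa G X ->
  (identifiable R G [set X]%SET [set Y]%SET <->
     exists Z : {set V}, adjustment_set R G [set X]%SET [set Y]%SET Z) /\
  ((exists Z : {set V}, adjustment_set R G [set X]%SET [set Y]%SET Z) ->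
     adjustment_set R G [set X]%SET [set Y]%SET (Pa G X)).
Proof.
move=> mG XY YP.
have crit Z : adjustment_set R G [set X]%SET [set Y]%SET Z ->
    no_undirected_start G X Y.
  by move=> aZ; apply: contrapT => nus; exact: (undirected_start_no_adjustment mG XY nus aZ).
have pa_adj : no_undirected_start G X Y ->
    adjustment_set R G [set X]%SET [set Y]%SET (Pa G X).
  by move=> nus; exact: (no_undirected_start_adjustment mG XY YP nus R).
split; last by move=> [Z /crit/pa_adj].
split=> [id|[Z /crit nus]]; last exact: (no_undirected_start_identifiable XY nus).
exists (Pa G X); apply: pa_adj; apply: contrapT => nus.
exact: (undirected_start_not_identifiable mG XY nus id).
Qed.
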